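(* Fix $k\ge 2$ and integers $n_1,\dots,n_k\ge 2$, set $N=\prod_{j=1}^k n_j$, let $\lambda\in\mathbb{R}^N$, let $U$ be a Haar-distributed random $N\times N$ unitary matrix and $H=U\,\mathrm{diag}(\lambda)\,U^\dagger$. Let $p_1,\dots,p_k$ be nonnegative integers and for $l=1,\dots,k$ fix $\bm{i}^{(l)}=(i^{(l)}_1,\dots,i^{(l)}_{p_l}),\ \bm{j}^{(l)}=(j^{(l)}_1,\dots,j^{(l)}_{p_l})\in\{1,\dots,n_l\}^{\times p_l}$. Then $$\mathbb{E}\left[\prod_{l=1}^k\prod_{\alpha=1}^{p_l}\pi_l(H)_{i^{(l)}_\alpha,j^{(l)}_\alpha}\right]=\sum_{\sigma,\tau\in\mathfrak{S}_{p_1+\cdots+p_k}}\mathrm{Wg}_N(\sigma^{-1}\tau)\,\mathrm{Tr}_\tau(\lambda)\prod_{l=1}^k\delta_{\mathrm{pr}_l(\sigma)}(\bm{i}^{(l)},\bm{j}^{(l)})\,n_l^{\kappa_l(\sigma)}.$$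
   Context: Identify $\mathbb{C}^N\cong\bigotimes_{j=1}^k\mathbb{C}^{n_j}$, indexing coordinates by multi-indices $(i_1,\dots,i_k)$, $1\le i_j\le n_j$, in lexicographic order. For $l=1,\dots,k$, $\pi_l(H)$ is the $n_l\times n_l$ matrix with $\pi_l(H)_{i_l,j_l}=\sum_{i_s,\ s\neq l} H_{i_1\dots i_l\dots i_k,\ i_1\dots j_l\dots i_k}$ (partial trace over all tensor factors except the $l$-th). Let $B_l=\{1+\sum_{j<l}p_j,\dots,\sum_{j\le l}p_j\}$. For $\sigma\in\mathfrak{S}_{p_1+\cdots+p_k}$: $\kappa_l(\sigma)$ is the number of cycles $c$ of $\sigma$ with $c\cap B_l=\emptyset$; $\mathrm{pr}_l(\sigma)\in\mathfrak{S}_{p_l}$ is obtained by writing $\sigma$ as a product of disjoint cycles, erasing all letters not in $B_l$, and relabeling each remaining letter $i+\sum_{j<l}p_j$ as $i$. For $\sigma\in\mathfrak{S}_d$ and sequences $\bm{a},\bm{b}$ of length $d$, $\delta_\sigma(\bm{a},\bm{b})=\prod_{r=1}^d\delta(a_{\sigma(r)},b_r)$ (Kronecker delta). For $\tau$ of cycle type $(\mu_1,\mu_2,\dots)$, $\mathrm{Tr}_\tau(\lambda)=\prod_j\mathrm{Tr}(\mathrm{diag}(\lambda)^{\mu_j})$. The unitary Weingarten function is $\mathrm{Wg}_N(\sigma)=\frac{1}{d!}\sum_{\rho\vdash d,\ C_\rho(N)\ne0}\frac{\chi^\rho(\mathrm{id}_d)\chi^\rho(\sigma)}{C_\rho(N)}$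 for $\sigma\in\mathfrak{S}_d$, with $\chi^\rho$ the irreducible character of $\mathfrak{S}_d$ for the partition $\rho$ and $C_\rho(N)=\prod_{i=1}^{\ell(\rho)}\prod_{j=1}^{\rho_i}(N+j-i)$. *)

(* Defs.v *)
From HB Require Import structures.
From mathcomp Require Import all_boot all_order all_algebra all_fingroup.
From mathcomp Require Import all_classical all_reals all_analysis.
From mathcomp Require Import complex.

Set Implicit Arguments.
Unset Strict Implicit.
Unset Printing Implicit Defensive.

Import Order.TTheory GRing.Theory Num.Theory.
Local Open Scope ring_scope.

Definition Ntot (k : nat) (n : 'I_k -> nat) : nat := (\prod_(j < k) n j)%N.

(* The lexicographic identification C^N = (x)_j C^{n_j}: the coordinate
   r : 'I_N (0-based) corresponds to the multi-index (i_1,...,i_k) (0-based)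
   with r = sum_j i_j * prod_{j' > j} n_{j'}; its j-th digit is: *)
Definition digit (k : nat) (n : 'I_k -> nat) (j : 'I_k) (r : nat) : nat :=
  ((r %/ \prod_(j' < k | (j < j')%N) n j') %% n j)%N.

Definition ptrace (C : pzRingType) (k : nat) (n : 'I_k -> nat) (l : 'I_k)
    (H : 'M[C]_(Ntot n)) : 'M[C]_(n l) :=
  \matrix_(a < n l, b < n l)
    \sum_(r < Ntot n) \sum_(s < Ntot n)
      if [&& digit n l r == a, digit n l s == b &
             [forall j : 'I_k, (j != l) ==> (digit n j r == digit n j s)]]
      then H r s else 0.

Definition off (k : nat) (p : 'I_k -> nat) (l : 'I_k) : nat :=
  (\sum_(j < k | (j < l)%N) p j)%N.

Definition inblock (k : nat) (p : 'I_k -> nat) (l : 'I_k) (x : nat) : bool :=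
  (off p l <= x < off p l + p l)%N.

Definition kappa (k : nat) (p : 'I_k -> nat) (l : 'I_k)
    (s : 'S_(\sum_(j < k) p j)) : nat :=
  #|[set c in porbits s | [forall x in c, ~~ inblock p l x]]|.

Definition permn (P : nat) (s : 'S_P) (x : nat) : nat :=
  if insub x is Some x' then val (s x') else x.

(* pr_l(sigma): erasing the letters not in B_l from the cycle notation of
   sigma sends each remaining letter x to the first letter of B_l met when
   following the cycle of x (x itself if none other); relabel by -off l. *)
Definition pr (k : nat) (p : 'I_k -> nat) (l : 'I_k)
    (s : 'S_(\sum_(j < k) p j)) (r : 'I_(p l)) : 'I_(p l) :=
  let P := (\sum_(j < k) p j)%N in
  let x := (off p l + r)%N in
  let m := find (fun m => inblock p l (iter m.+1 (permn s) x)) (iota 0 P) in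
  insubd r (iter m.+1 (permn s) x - off p l)%N.

Definition deltap (C : pzRingType) (q m : nat) (f : 'I_q -> 'I_q)
    (a b : 'I_q -> 'I_m) : C :=
  \prod_(r < q) (a (f r) == b r)%:R.

Definition Trperm (C : pzRingType) (d N : nat) (t : 'S_d) (lam : 'I_N -> C) : C :=
  \prod_(c in porbits t) \sum_(r < N) lam r ^+ #|c|.

Definition is_partition (d : nat) (rho : 'I_d -> nat) : bool :=
  ((\sum_(i < d) rho i)%N == d) &&
  [forall i : 'I_d, forall j : 'I_d, (i <= j)%N ==> (rho j <= rho i)%N].

(* chi^rho(sigma), via the Frobenius character formula with d variables:
   chi^rho(sigma) = [x^(rho + delta)] a_delta(x) * prod_{cycles c} p_{|c|}(x),
   delta = (d-1, ..., 1, 0), a_delta = det(x_i^{delta_j}) = sum_w sgn(w)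
   prod_i x_i^{delta_{w i}}, and prod_c p_{|c|}(x) = sum over colourings g of
   the letters constant on cycles of prod_x x_{g x}. *)
Definition schar (d : nat) (rho : 'I_d -> nat) (s : 'S_d) : int :=
  \sum_(w : 'S_d)
   \sum_(g : {ffun 'I_d -> 'I_d} | [forall x, g (s x) == g x])
     (-1) ^+ odd_perm w *
     ([forall i : 'I_d,
        ((d.-1 - w i) + #|[set x | g x == i]| == rho i + (d.-1 - i))%N] : int).

Definition Crho (d : nat) (rho : 'I_d -> nat) (N : nat) : int :=
  \prod_(i < d) \prod_(j < rho i) (N%:Z + j%:Z - i%:Z).

Definition Wg (F : fieldType) (N d : nat) (s : 'S_d) : F :=
  (d`!%:R)^-1 *
  \sum_(rho : {ffun 'I_d -> 'I_d.+1} |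
          is_partition (fun i => nat_of_ord (rho i)) &&
          (Crho (fun i => nat_of_ord (rho i)) N != 0))
    (schar (fun i => nat_of_ord (rho i)) 1)%:~R *
    (schar (fun i => nat_of_ord (rho i)) s)%:~R /
    (Crho (fun i => nat_of_ord (rho i)) N)%:~R.

Local Open Scope complex_scope.

Definition adj (R : realType) (N : nat) (M : 'M[R[i]]_N) : 'M[R[i]]_N :=
  (map_mx (@conjc R) M)^T.

Definition unitary (R : realType) (N : nat) (M : 'M[R[i]]_N) : Prop :=
  M *m adj M = 1%:M.

(* real coordinates of a complex matrix (real and imaginary parts of its
   entries), as an element of the measurable space (N*N).-tuple (R * R)
   (product of Borel sigma-algebras, i.e. the Borel sets of R^(2N^2)) *)
Definition mxcoords (R : realType) (N : nat) (M : 'M[R[i]]_N)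
    : (N * N).-tuple (R * R)%type :=
  [tuple (complex.Re (mxvec M 0 q), complex.Im (mxvec M 0 q)) | q < N * N].

(* U : Omega -> U(N) is Haar-distributed under P: U is unitary, its law
   (a Borel probability measure on U(N)) is well defined and invariant
   under left multiplication by any unitary V (hence is the Haar measure). *)
Definition haar_distributed (R : realType) (d : measure_display)
    (Omega : measurableType d) (P : probability Omega R) (N : nat)
    (U : Omega -> 'M[R[i]]_N) : Prop :=
  [/\ forall w, unitary (U w),
      measurable_fun setT (fun w => mxcoords (U w)) &
      forall V : 'M[R[i]]_N, unitary V ->
      forall A : set ((N * N).-tuple (R * R)%type), measurable A ->
        P [set w | A (mxcoords (V *m U w))]%classic = P [set w | A (mxcoords (U w))]%classic].

Definition cexpect (R : realType) (d : measure_display)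
    (Omega : measurableType d) (P : probability Omega R) (f : Omega -> R[i])
    : R[i] :=
  (Rintegral P setT (fun w => complex.Re (f w)))%:C +
  'i * (Rintegral P setT (fun w => complex.Im (f w)))%:C.

(* Main.v *)
(** Invariance of the law of [U] under left multiplication makes the kernel of
    [E[H^(x)d]] on [(C^N)^(x)d] commute with [V^(x)d] for all unitary [V], hence
    (diagonal matrices, then normal ones, then polynomiality) with [X^(x)d] for
    every matrix [X], hence (polarization) with every operator invariant under
    [S_d]. The map [Q X = sum_(s, t) Wg (s^-1 t) Tr (X P_t^-1) P_s] commutes with
    right multiplication by permutation operators, so it is a sum of operators
    [Y X T] with [T] invariant; as soon as [Q 1 = 1] it therefore fixes
    [E[H^(x)d]], and [Tr (E[H^(x)d] P_t^-1)] is a product of power sums of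
    [lambda]. Expanding the partial traces digit by digit and counting the
    colourings of the letters then gives the theorem.

    The identity [Q 1 = 1] is the Weingarten calculus: writing [G t] for the
    trace [N ^ #cycles t] of [P_t], it follows from
    [sum_t chi^rho (s t) G t = C_rho(N) chi^rho s] and from
    [sum_rho chi^rho 1 chi^rho s = d! [s = 1]]. With [l = rho + delta],
    Frobenius' formula and Burnside counting give
    [sum_s chi^rho s p_s(y) = d! det (h_(l_i - delta_j)(y))]. For [y] the
    variables, multiplying by the alternant turns the determinant into
    [det (y_j ^ l_i)], so the [chi^rho] are orthonormal virtual characters, that
    is, irreducible up to sign; for [y = (1, .., 1)], column operations evaluate
    the determinant as a multiple of the content product [C_rho(N)]. *)
Require Import Defs.
From HB Require Import structures.
From mathcomp Require Import all_boot all_order all_algebra all_fingroup.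
From mathcomp Require Import algC all_character.
From mathcomp Require Import all_classical all_reals all_analysis.
From mathcomp Require Import measurable_realfun.
From mathcomp Require Import complex.
From mathcomp Require mpoly.
Import (canonicals, coercions) mpoly.
From mathcomp Require Import ring lra zify.
Import Order.TTheory GRing.Theory Num.Theory.
Local Open Scope ring_scope.
Local Open Scope complex_scope.

Set Implicit Arguments.
Unset Strict Implicit.
Unset Printing Implicit Defensive.

(** * Colourings of the letters *)

Section Colourings.
Variables (d : nat) (T : finType).
Implicit Types (f g : {ffun 'I_d -> T}) (s : 'S_d).

Definition colcount f : {ffun T -> nat} := [ffun t => #|[set x | f x == t]|].

(** Products of permutations are read from left to right, so this is a left action. On multi-indices
    its matrices are the permutation operators. *)
Definition recolor f s : {ffun 'I_d -> T} := [ffun x => f (s x)].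

Lemma recolorE f s : (recolor f s == f) = [forall x, f (s x) == f x].
Proof.
apply/eqP/forallP => [e x|e]; first by rewrite -{2}e ffunE.
by apply/ffunP => x; rewrite ffunE (eqP (e x)).
Qed.

Lemma recolorM f s t : recolor f (s * t)%g = recolor (recolor f t) s.
Proof. by apply/ffunP => x; rewrite !ffunE permM. Qed.

Lemma recolor1 f : recolor f 1 = f.
Proof. by apply/ffunP => x; rewrite ffunE perm1. Qed.

Lemma recolor_inj s : injective (recolor^~ s).
Proof.
by move=> f g e; rewrite -[f]recolor1 -[g]recolor1 -(mulVg s) !recolorM /= e.
Qed.

Lemma colcount_recolor f s : colcount (recolor f s) = colcount f.
Proof.
apply/ffunP => t; rewrite !ffunE -(card_imset _ (@perm_inj _ s)).
apply: eq_card => x; rewrite inE; apply/imsetP/idP => [[y]|fx].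
  by rewrite inE ffunE => fy ->.
by exists (s^-1 x)%g; rewrite ?inE ?ffunE permKV.
Qed.

Lemma colcount_count f t : colcount f t = count_mem t (codom f).
Proof.
rewrite ffunE count_map enumT cardE /enum_mem size_filter.
by apply: eq_count => x; rewrite /= inE.
Qed.


(** Equal counts make the lists of colours rearrangements of each other. *)
Lemma colcount_eq f g : colcount f = colcount g -> exists s, f = recolor g s.
Proof.
move=> e; have : perm_eq (codom f) [tuple g i | i < d].
  by apply/allP => t _ /=; rewrite -colcount_count e colcount_count.
move=> /tuple_permP[p ep]; exists p; apply/ffunP => i.
have sz : (i < size (codom f))%N by rewrite size_codom card_ord.
have := congr1 (fun l => nth (f i) l i) ep.
rewrite -(tnth_nth (f i) [tuple tnth [tuple g i0 | i0 < d] (p i0) | i0 < d]).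
rewrite !tnth_mktuple ffunE => <-; rewrite (nth_map i) ?nth_ord_enum//.
by rewrite -cardE card_ord.
Qed.

Lemma colcount_surj (a : {ffun T -> nat}) :
  (\sum_t a t = d)%N -> exists f, colcount f = a.
Proof.
move=> ad; pose l := flatten [seq nseq (a t) t | t <- enum T].
have sl : size l == d.
  rewrite size_flatten /shape -map_comp sumnE big_map -ad big_enum /=.
  by apply/eqP/eq_bigr => t _; rewrite size_nseq.
exists [ffun i => tnth (Tuple sl) i]; apply/ffunP => t; rewrite colcount_count.
have -> : codom [ffun i => tnth (Tuple sl) i] = l.
  rewrite -[RHS](map_tnth_enum (Tuple sl)) /codom /image_mem.
  by apply: eq_map => i; rewrite ffunE.
rewrite count_flatten -map_comp sumnE big_map big_enum /= (bigD1 t)//=.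
rewrite count_nseq /= eqxx mul1n big1 ?addn0// => u ut.
by rewrite count_nseq /= (negPf ut).
Qed.

Lemma sum_colcount f : (\sum_t colcount f t = d)%N.
Proof.
rewrite -[RHS]card_ord -[in RHS]sum1_card (partition_big f predT)//=.
apply: eq_bigr => t _; rewrite ffunE sum1_card; apply: eq_card => x.
by rewrite inE.
Qed.

(* The colourings with the same colour counts as [f] form the orbit of [f], and
   stabilizers in an orbit are equinumerous. *)
Lemma sum_stabilizers f :
  (\sum_(g | colcount g == colcount f) #|[set s | recolor g s == g]| = d`!)%N.
Proof.
rewrite -card_Sn -[RHS]sum1_card.
rewrite (partition_big (recolor f) (fun g => colcount g == colcount f))/=; last first.
  by move=> s _; rewrite colcount_recolor.
apply: eq_bigr => _ /eqP /colcount_eq[t ->]; rewrite sum1dep_card.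
rewrite -[LHS](card_imset _ (@mulIg _ t)); apply: eq_card => s.
rewrite [RHS]inE; apply/imsetP/eqP => [[u]|e].
  by rewrite inE => /eqP e ->; rewrite recolorM.
by exists (s * t^-1)%g; rewrite ?mulgKV// inE -recolorM mulgKV e.
Qed.

(** Burnside counting: the colourings with prescribed counts form one orbit, whose stabilizers have
    total size [d!]. As no count exceeds [d], the bound [M] lets the counts range over a finite
    type. *)
Lemma sum_fixed_colcount (R : comPzRingType) (M : nat) (F : {ffun T -> nat} -> R) :
  (d <= M)%N ->
  \sum_f \sum_(s | recolor f s == f) F (colcount f) =
  d`!%:R * \sum_(a : {ffun T -> 'I_M.+1} | (\sum_t a t == d)%N)
     F [ffun t => nat_of_ord (a t)].
Proof.
move=> dM; pose p f := [ffun t => inord (colcount f t) : 'I_M.+1].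
have pK f : [ffun t => nat_of_ord (p f t)] = colcount f.
  apply/ffunP => t; rewrite !ffunE inordK// ltnS.
  by rewrite (leq_trans (max_card _))// card_ord.
rewrite (partition_big p (fun a => (\sum_t a t == d)%N))/=; last first.
  move=> f _; rewrite -[X in _ == X](sum_colcount f) -pK; apply/eqP.
  by apply: eq_bigr => t _; rewrite [in RHS]ffunE.
rewrite big_distrr/=; apply: eq_bigr => a /eqP ad.
have [|f0 ef0] := @colcount_surj [ffun t => nat_of_ord (a t)].
  by rewrite -[RHS]ad; apply: eq_bigr => t _; rewrite ffunE.
rewrite -(sum_stabilizers f0) natr_sum mulr_suml; apply: eq_big => [f|f].
  apply/eqP/eqP => [e|]; first by rewrite ef0 -e pK.
  rewrite ef0 -(pK f) => e; apply/ffunP => t; apply: val_inj.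
  by have := congr1 (fun h : {ffun T -> nat} => h t) e; rewrite [LHS]ffunE [RHS]ffunE.
move=> /eqP <-; rewrite sumr_const pK mulr_natl; congr (_ *+ _).
by apply: eq_card => s; rewrite inE.
Qed.

End Colourings.

(** * Power sums and complete homogeneous functions *)

Section PowerSums.
Variables (d : nat) (R : comNzRingType).

(** The power sum symmetric function of the cycle type of [s], expanded over the colourings that are
    constant on cycles. *)
Definition powersum (T : finType) (y : T -> R) (s : 'S_d) : R :=
  \sum_(f : {ffun 'I_d -> T} | recolor f s == f) \prod_x y (f x).

(** For [P = pred1 al], the coefficient of the monomial of exponent [al] in the power sum of [s],
    and also the value at [s] of a permutation character. *)
Definition ncolcount (T : finType) (P : pred {ffun T -> nat}) (s : 'S_d) : nat :=
  #|[set f : {ffun 'I_d -> T} | (recolor f s == f) && P (colcount f)]|.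

(* The truncation [M] makes the product over [t] of the geometric series in
   [y t * 'X] a polynomial; below degree [M] its coefficients are the complete
   homogeneous symmetric functions. *)
Definition hgen (T : finType) (M : nat) (y : T -> R) : {poly R} :=
  \prod_t \sum_(a < M.+1) (y t ^+ a) *: 'X^a.

Lemma coef_hgen (T : finType) (M m : nat) (y : T -> R) :
  (hgen M y)`_m =
  \sum_(b : {ffun T -> 'I_M.+1} | (\sum_t b t == m)%N) \prod_t y t ^+ b t.
Proof.
rewrite /hgen bigA_distr_bigA /= coef_sum [RHS]big_mkcond; apply: eq_bigr => b _.
rewrite (eq_bigr (fun t => (y t ^+ b t)%:P * 'X^(b t))); last first.
  by move=> t _; rewrite mul_polyC.
rewrite big_split/= -rmorph_prod/= mul_polyC coefZ.
rewrite -expr_sum coefXn eq_sym.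
by case: eqP; rewrite ?mulr1 ?mulr0.
Qed.

Lemma prod_colcount (T : finType) (y : T -> R) (f : {ffun 'I_d -> T}) :
  \prod_x y (f x) = \prod_t y t ^+ colcount f t.
Proof.
rewrite (partition_big f predT)//=; apply: eq_bigr => t _.
rewrite (eq_bigr (fun=> y t)) => [|x /eqP ->//].
by rewrite prodr_const ffunE; congr (_ ^+ _); apply: eq_card => x; rewrite inE.
Qed.

(** Two colourings fixed by [s] amount to one with colours in [I * T], to which Burnside counting
    applies. Its counts form a matrix with row sums [al], and each row contributes one complete
    homogeneous function. *)
Lemma sum_ncolcount_powersum (I T : finType) (M : nat) (y : T -> R)
    (al : {ffun I -> nat}) : (d <= M)%N -> (\sum_i al i = d)%N ->
  \sum_s (ncolcount (pred1 al) s)%:R * powersum y s =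
  d`!%:R * \prod_i (hgen M y)`_(al i).
Proof.
move=> dM sal.
pose F (c : {ffun I * T -> nat}) : R :=
  [forall i, \sum_t c (i, t) == al i]%N%:R * \prod_u y u.2 ^+ c u.
have -> : \sum_s (ncolcount (pred1 al) s)%:R * powersum y s =
    \sum_(k : {ffun 'I_d -> I * T}) \sum_(s | recolor k s == k) F (colcount k).
  rewrite (exchange_big_dep predT)//=; apply: eq_bigr => s _.
  rewrite /ncolcount -sum1dep_card natr_sum mulr_suml.
  rewrite [LHS](eq_bigr (fun=> powersum y s)) => [|f _]; last by rewrite mulr1n mul1r.
  rewrite /powersum.
  rewrite pair_big/= (reindex (fun k : {ffun 'I_d -> I * T} =>
     ([ffun x => (k x).1], [ffun x => (k x).2]))) /=; last first.
    exists (fun fg : {ffun 'I_d -> I} * {ffun 'I_d -> T} => [ffun x => (fg.1 x, fg.2 x)]) => [k _|[f g] _].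
      by apply/ffunP => x; rewrite !ffunE; case: (k x).
    by congr pair; apply/ffunP => x; rewrite !ffunE.
  have cE (k : {ffun 'I_d -> I * T}) : F (colcount k) =
      (colcount [ffun x => (k x).1] == al)%:R * \prod_x y (k x).2.
    rewrite /F (@prod_colcount _ (fun u => y u.2) k); congr (_%:R * _).
    suff e i : (\sum_t colcount k (i, t) = colcount [ffun x => (k x).1] i)%N.
      congr nat_of_bool; apply/forallP/eqP => [H|<- i]; last by rewrite e.
      by apply/ffunP => i; rewrite -e (eqP (H i)).
    rewrite ffunE -sum1dep_card (partition_big (fun x => (k x).2) predT)//=.
    apply: eq_bigr => t _; rewrite ffunE sum1dep_card.
    by apply: eq_card => x; rewrite !inE ffunE -pair_eqE.
  under [RHS]eq_bigr do rewrite cE.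
  rewrite big_mkcond [RHS]big_mkcond; apply: eq_bigr => k _.
  have -> : (recolor k s == k) =
     (recolor [ffun x => (k x).1] s == [ffun x => (k x).1]) &&
     (recolor [ffun x => (k x).2] s == [ffun x => (k x).2]).
    rewrite !recolorE; apply/forallP/andP => [H|[/forallP H1 /forallP H2] x].
      by split; apply/forallP => x; rewrite !ffunE (eqP (H x)).
    move: (H1 x) (H2 x); rewrite !ffunE => /eqP e1 /eqP e2.
    by rewrite [k (s x)]surjective_pairing e1 e2 -surjective_pairing.
  rewrite /= andbAC; case: eqP => _ //=.
  case: (_ =P al) => _; rewrite (andbT, andbF) /= ?mul0r ?if_same// mul1r.
  by under eq_bigr do rewrite ffunE.
rewrite (sum_fixed_colcount F dM); congr (_ * _).
under [RHS]eq_bigr do rewrite coef_hgen.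
under [RHS]eq_bigr do rewrite big_mkcond.
rewrite bigA_distr_bigA /= (reindex (fun B : {ffun I -> {ffun T -> 'I_M.+1}} =>
   [ffun u => B u.1 u.2])) /=; last first.
  exists (fun a : {ffun I * T -> 'I_M.+1} => [ffun i => [ffun t => a (i, t)]]) => [B _|a _].
    by apply/ffunP => i; apply/ffunP => t; rewrite !ffunE.
  by apply/ffunP => [[i t]]; rewrite !ffunE.
rewrite big_mkcond; apply: eq_bigr => B _.
rewrite /F; under [in X in X%:R]eq_forallb => i do
  under eq_bigr do rewrite !ffunE /=.
case: (boolP [forall i, (\sum_t B i t == al i)%N]) => [/forallP H|].
  rewrite ifT; last first.
    rewrite -[X in _ == X]sal (eq_bigr (fun u => nat_of_ord (B u.1 u.2))); last first.
      by move=> u _; rewrite ffunE.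
    rewrite -(pair_bigA _ (fun i t => nat_of_ord (B i t)))/=.
    by apply/eqP; apply: eq_bigr => i _; rewrite (eqP (H i)).
  rewrite mul1r (eq_bigr (fun u => y u.2 ^+ B u.1 u.2)); last first.
    by move=> u _; rewrite !ffunE.
  rewrite -(pair_bigA _ (fun i t => y t ^+ B i t))/=.
  by apply: eq_bigr => i _; rewrite H.
rewrite negb_forall => /existsP[i Hi]; rewrite mul0r if_same.
by rewrite (bigD1 i)//= (negPf Hi) mul0r.
Qed.

End PowerSums.

(** * The Frobenius formula *)

Section FrobeniusFormula.
Variables (d : nat).
Implicit Types (rho mu : 'I_d -> nat) (s w : 'S_d).

Definition shifted rho (i : 'I_d) : nat := (rho i + (d.-1 - i))%N.

(** The counts [c] for which the term [w] of the alternant times the monomial of exponent [c] is the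
    monomial of exponent [rho + delta]. *)
Definition shift_pred rho w (c : {ffun 'I_d -> nat}) : bool :=
  [forall i, ((d.-1 - w i) + c i == shifted rho i)%N].

(** The only counts that can satisfy [shift_pred rho w]. The subtraction is truncated, so they do
    satisfy it only when no difference is negative. *)
Definition shift_content rho w : {ffun 'I_d -> nat} :=
  [ffun i => (shifted rho i - (d.-1 - w i))%N].

Lemma scharE rho s :
  schar rho s =
  \sum_w (-1) ^+ odd_perm w * (ncolcount (shift_pred rho w) s)%:R.
Proof.
apply: eq_bigr => w _; rewrite /ncolcount -sum1dep_card natr_sum big_distrr/=.
rewrite [RHS]big_mkcondr; apply: eq_big => [g|g _]; first by rewrite recolorE.
rewrite (_ : [forall i, _] = shift_pred rho w (colcount g)).
  by case: ifP => _; rewrite ?mulr1// mulr0.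
by apply: eq_forallb => i; rewrite ffunE.
Qed.

Lemma shift_predE rho w :
  shift_pred rho w =1
  if [forall i, (d.-1 - w i <= shifted rho i)%N] then pred1 (shift_content rho w)
  else pred0.
Proof.
move=> c; case: ifP => [/forallP H|/negbT].
  apply/forallP/eqP => [e|-> i]; last by rewrite ffunE subnKC.
  by apply/ffunP => i; rewrite ffunE -(eqP (e i)) addKn.
move=> /forallPn [i ]; rewrite -ltnNge => Hi.
apply/negbTE/forallPn; exists i.
by rewrite gtn_eqF// ltn_addr.
Qed.

Lemma sum_shift_content rho w : (\sum_i rho i = d)%N ->
  [forall i, (d.-1 - w i <= shifted rho i)%N] ->
  (\sum_i shift_content rho w i = d)%N.
Proof.
move=> sr /forallP H; under eq_bigr do rewrite ffunE.
rewrite sumnB; last by move=> i _; exact: H.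
rewrite big_split/= sr [X in (_ + X - _)%N](reindex_inj (@perm_inj _ w))/=.
by rewrite addnK.
Qed.

Lemma ncolcount_ext (P Q : pred {ffun 'I_d -> nat}) s : P =1 Q ->
  ncolcount P s = ncolcount Q s.
Proof. by move=> e; apply: eq_card => f; rewrite !inE e. Qed.

Lemma ncolcount0 (P : pred {ffun 'I_d -> nat}) s : P =1 pred0 -> ncolcount P s = 0%N.
Proof. by move=> e; apply: eq_card0 => f; rewrite !inE e andbF. Qed.

Section Det.
Variables (R : comNzRingType) (T : finType) (M : nat) (y : T -> R).

(* Complete homogeneous symmetric functions of degree [l - e], which is an
   integer: they vanish in negative degree. *)
Definition hsym (l e : nat) : R :=
  if (e <= l)%N then (hgen M y)`_(l - e) else 0.

Definition hmatrix rho : 'M[R]_d :=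
  \matrix_(i, j) hsym (shifted rho i) (d.-1 - j).

(** The Jacobi-Trudi determinant: the signed sum over [w] defining the character becomes the Leibniz
    expansion, and a [w] with a negative difference contributes zero to both sides. *)
Lemma sum_schar_powersum rho : (d <= M)%N -> (\sum_i rho i = d)%N ->
  \sum_s (schar rho s)%:~R * powersum y s = d`!%:R * \det (hmatrix rho).
Proof.
move=> dM sr; under eq_bigr do rewrite scharE rmorph_sum mulr_suml.
rewrite exchange_big big_distrr/=; apply: eq_bigr => w _.
under eq_bigr do rewrite rmorphM rmorph_sign natz -mulrA.
rewrite -big_distrr/= mulrCA; congr (_ * _).
under eq_bigr do rewrite -pmulrn.
under eq_bigr do rewrite (ncolcount_ext _ (shift_predE rho w)).
case: ifPn => H.
  rewrite (sum_ncolcount_powersum _ dM (sum_shift_content sr H)).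
  congr (_ * _); apply: eq_bigr => i _.
  by rewrite !mxE /hsym (forallP H) ffunE.
rewrite big1 => [|s _]; last by rewrite ncolcount0 ?mul0r.
move: H => /forallPn[i Hi].
by rewrite (bigD1 i)//= mxE /hsym (negPf Hi) mul0r mulr0.
Qed.

End Det.

(** * The bialternant formula *)

Section Bialternant.
Variables (R : comNzRingType) (M : nat) (y : 'I_d -> R).

Lemma coef_mul_truncation (T : finType) (Q : pred T) (c : T -> R) (p : {poly R}) l :
  (l <= M)%N -> (p * \prod_(t | Q t) (1 - c t *: 'X^(M.+1)))`_l = p`_l.
Proof.
move=> lM; elim/big_ind : _ p => [p|q1 q2 H1 H2 p|t _ p]; first by rewrite mulr1.
  by rewrite mulrA H2 H1.
by rewrite mulrBr mulr1 coefB -scalerAr coefZ coefMXn ltnS lM mulr0 subr0.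
Qed.

(** The generating function, up to signs, of the elementary symmetric functions in the variables
    other than [y j]. *)
Definition elem_but (j : 'I_d) : {poly R} := \prod_(t | t != j) (1 - y t *: 'X).

Lemma size_elem_but j : (size (elem_but j) <= d)%N.
Proof.
have d0 : (0 < d)%N by case: d j => [[]|].
have cj : #|[pred t | t != j]| = d.-1 by rewrite -[in RHS](card_ord d) -(cardC1 j).
have : (\sum_(t | t != j) size (1 - y t *: 'X)%R <= d.-1 * 2)%N.
  rewrite -cj -sum_nat_const leq_sum// => t _.
  rewrite (leq_trans (size_polyD _ _))// size_polyN size_poly1 geq_max /=.
  by rewrite (leq_trans (size_scale_leq _ _))// size_polyX.
move=> H; rewrite (leq_trans (size_prod_leq [pred t | t != j] _))//= cj.
by rewrite leq_subLR (leq_ltn_trans H)//; lia.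
Qed.

Lemma geometric_trunc (a : R) :
  (\sum_(k < M.+1) a ^+ k *: 'X^k) * (1 - a *: 'X) = 1 - a ^+ M.+1 *: 'X^(M.+1).
Proof.
have := subrXX 1 (a *: 'X) M.+1; rewrite expr1n exprZn => ->; rewrite mulrC.
by congr (_ * _); apply: eq_bigr => k _; rewrite expr1n mul1r exprZn.
Qed.

(** Up to degree [M], [hgen] is the product of the [1 / (1 - y t X)], and all factors but that of
    [j] cancel. *)
Lemma hgen_elem_but (j : 'I_d) l : (l <= M)%N -> (hgen M y * elem_but j)`_l = y j ^+ l.
Proof.
move=> lM; rewrite /hgen /elem_but (bigD1 j)//= -mulrA -big_split/=.
under [in X in _ * X]eq_bigr do rewrite geometric_trunc.
rewrite coef_mul_truncation// coef_sum (bigD1 (Ordinal (lM : (l < M.+1)%N)))//=.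
rewrite coefZ coefXn eqxx mulr1 big1 ?addr0// => k kl.
rewrite coefZ coefXn (_ : (l == k) = false) ?mulr0//.
by apply/negbTE; apply: contra kl => /eqP e; apply/eqP/val_inj.
Qed.

Definition elem_matrix : 'M[R]_d := \matrix_(k, j) (elem_but j)`_(d.-1 - k).

Lemma sum_ord_widen (V : nmodType) (m n : nat) (F : nat -> V) :
  (forall k, (m <= k)%N -> F k = 0) -> \sum_(k < m + n) F k = \sum_(k < m) F k.
Proof.
move=> F0; rewrite big_split_ord/= [X in _ + X]big1 ?addr0// => k _.
by rewrite F0// leq_addr.
Qed.

Lemma hmatrix_elem rho : (forall i, shifted rho i <= M)%N ->
  hmatrix M y rho *m elem_matrix = \matrix_(i, j) y j ^+ shifted rho i.
Proof.
move=> lM; apply/matrixP => i j; rewrite !mxE -(hgen_elem_but _ (lM i)).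
set l := shifted rho i; pose F k := hsym M y l k * (elem_but j)`_k.
rewrite (reindex_inj rev_ord_inj)/= (eq_bigr (fun k : 'I_d => F k)); last first.
  move=> k _; rewrite !mxE /F/=.
  by rewrite (_ : (d.-1 - (d - k.+1))%N = k)//; have := ltn_ord k; lia.
(* The sum over [k < d] and the convolution over [k <= l] are both extended to [d + l.+1] terms:
   [elem_but j] has degree below [d], and [hsym] vanishes past [l]. *)
rewrite -(sum_ord_widen l.+1) => [|k dk]; last first.
  by rewrite /F [X in _ * X]nth_default ?mulr0// (leq_trans (size_elem_but j)).
rewrite addnC sum_ord_widen => [|k lk]; last first.
  by rewrite /F /hsym leqNgt lk mul0r.
by rewrite coefMr; apply: eq_bigr => k _; rewrite /F /hsym -ltnS ltn_ord.
Qed.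

(** For [rho = 0] the matrix is upper unitriangular, since [h_0 = 1] and negative degrees vanish. *)
Lemma det_hmatrix0 : (d <= M)%N -> \det (hmatrix M y (fun=> 0%N)) = 1.
Proof.
move=> dM; rewrite -det_tr det_trig; last first.
  apply/is_trig_mxP => i j ij; rewrite !mxE /hsym /shifted add0n leqNgt.
  by rewrite (_ : (_ < _)%N) //; have := ltn_ord j; lia.
rewrite big1 // => i _; rewrite !mxE /hsym /shifted add0n leqnn subnn.
rewrite coef_hgen (big_pred1 [ffun=> ord0]) => [|b].
  by rewrite big1// => t _; rewrite ffunE expr0.
rewrite /= sum_nat_eq0; apply/forallP/eqP => [H|-> t]; last by rewrite ffunE.
by apply/ffunP => t; rewrite ffunE; apply/val_inj/eqP; apply: H.
Qed.

(** The case [rho = 0] of the matrix identity evaluates the determinant of [elem_matrix] as the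
    Vandermonde determinant. *)
Lemma det_hmatrix_vandermonde rho : (2 * d <= M)%N ->
  (forall i, shifted rho i <= M)%N ->
  \det (hmatrix M y rho) * \det (\matrix_(i < d, j < d) y j ^+ (d.-1 - i)) =
  \det (\matrix_(i < d, j < d) y j ^+ shifted rho i).
Proof.
move=> dM lM; rewrite -hmatrix_elem// det_mulmx; congr (_ * _).
have := hmatrix_elem (rho := fun=> 0%N); rewrite /shifted /= => <-.
  by rewrite det_mulmx det_hmatrix0 ?mul1r//; lia.
by move=> i; have := ltn_ord i; lia.
Qed.

End Bialternant.

(** * Orthogonality of the characters *)

Section Orthogonality.

Definition monomial (a : {ffun 'I_d -> nat}) : mpoly.multinom d :=
  mpoly.Multinom [tuple a i | i < d].

Definition var (i : 'I_d) : mpoly.mpoly d int :=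
  mpoly.mpolyX int (mpoly.mnm1 i).

Lemma coef_monomial (a b : {ffun 'I_d -> nat}) :
  mpoly.mcoeff (monomial a) (\prod_i var i ^+ b i) = (b == a)%:R.
Proof.
have mE (c : {ffun 'I_d -> nat}) i : monomial c i = c i by rewrite mpoly.mnmE.
have -> : \prod_i var i ^+ b i = mpoly.mpolyX int (monomial b).
  by rewrite mpoly.mpolyXE_id; apply: eq_bigr => i _; rewrite mE.
rewrite mpoly.mcoeffX; congr (nat_of_bool _)%:R.
apply/eqP/eqP => [e|->//]; apply/ffunP => i.
by rewrite -!mE e.
Qed.

Lemma increasing_perm_ge w :
  (forall i j : 'I_d, (i < j)%N -> (w i < w j)%N) -> forall i : 'I_d, (i <= w i)%N.
Proof.
move=> wD i; have [k] := ubnP (val i); elim: k i => // k IH i ik.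
have [->//|i0] := posnP (val i).
have i1 : (i.-1 < d)%N by rewrite (leq_ltn_trans (leq_pred _)).
have lt1 : (i.-1 < i)%N by rewrite prednK.
have ltk : (i.-1 < k)%N by rewrite (leq_trans lt1)// -ltnS.
by rewrite -(prednK i0) (leq_ltn_trans (IH (Ordinal i1) ltk) (wD (Ordinal i1) i lt1)).
Qed.

(** Both [w] and its inverse are increasing, so neither lowers an index. *)
Lemma decreasing_perm (l m : 'I_d -> nat) w :
  (forall i j : 'I_d, (i < j)%N -> (l j < l i)%N) ->
  (forall i j : 'I_d, (i < j)%N -> (m j < m i)%N) ->
  (forall i, l (w i) = m i) -> w = 1%g.
Proof.
move=> lD mD lm.
have wD (i j : 'I_d) : (i < j)%N -> (w i < w j)%N.
  move=> ij; rewrite ltnNge leq_eqVlt; apply/negP => /orP[/eqP/val_inj/perm_inj e|].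
    by rewrite e ltnn in ij.
  by move=> /lD; rewrite !lm ltnNge ltnW// mD.
have wVD (i j : 'I_d) : (i < j)%N -> (w^-1%g i < w^-1%g j)%N.
  rewrite !ltnNge; apply: contra; rewrite leq_eqVlt => /orP[/eqP/val_inj/perm_inj ->//|].
  by move=> /wD; rewrite !permKV => /ltnW.
apply/permP => i; rewrite perm1; apply/val_inj/eqP => /=.
rewrite eqn_leq (increasing_perm_ge wD) andbT.
by have := increasing_perm_ge wVD (w i); rewrite permK.
Qed.

Lemma shifted_decreasing rho : is_partition rho ->
  forall i j : 'I_d, (i < j)%N -> (shifted rho j < shifted rho i)%N.
Proof.
move=> /andP[_ /forallP H] i j ij; have := implyP (forallP (H i) j) (ltnW ij).
by rewrite /shifted; have := ltn_ord j; lia.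
Qed.

Lemma shifted_le rho i : is_partition rho -> (shifted rho i <= 2 * d)%N.
Proof.
move=> /andP[/eqP sr _]; have : (rho i <= d)%N.
  by rewrite -[X in (_ <= X)%N]sr (bigD1 i)//= leq_addr.
by rewrite /shifted; lia.
Qed.

(* The alternant of the exponents [d.-1, .., 0] times a power sum: the
   generating function in the definition of [schar]. *)
Lemma coef_alternant_powersum mu s :
  mpoly.mcoeff (monomial [ffun i => shifted mu i])
    (powersum var s * \det (\matrix_(i < d, j < d) var j ^+ (d.-1 - i))) = schar mu s.
Proof.
rewrite -det_tr /powersum mulr_suml raddf_sum/= scharE.
transitivity (\sum_(f : {ffun 'I_d -> 'I_d} | recolor f s == f)
  \sum_w (-1) ^+ odd_perm w * (shift_pred mu w (colcount f))%:R : int).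
  apply: eq_bigr => f _; rewrite big_distrr raddf_sum/=; apply: eq_bigr => w _.
  rewrite prod_colcount mulrCA -big_split/=.
  rewrite (eq_bigr (fun i => var i ^+ [ffun i => (d.-1 - w i + colcount f i)%N] i)); last first.
    by move=> i _; rewrite !mxE -exprD addnC [in RHS]ffunE.
  have -> : shift_pred mu w (colcount f) =
      ([ffun i => (d.-1 - w i + colcount f i)%N] == [ffun i => shifted mu i]).
    apply/forallP/eqP => [e|/ffunP e i].
      by apply/ffunP => i; rewrite [LHS]ffunE [RHS]ffunE (eqP (e i)).
    by have := e i; rewrite [LHS]ffunE [RHS]ffunE => ->.
  case: (odd_perm w); last by rewrite !expr0 !mul1r coef_monomial.
  by rewrite !expr1 !mulN1r raddfN /= coef_monomial.
rewrite exchange_big/=; apply: eq_bigr => w _.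
rewrite -big_distrr/= /ncolcount -sum1dep_card natr_sum [in RHS]big_mkcondr.
by congr (_ * _); apply: eq_bigr => f _; case: ifP.
Qed.

(** The Jacobi-Trudi identity is multiplied by the alternant and the coefficient of exponent
    [mu + delta] is extracted: the power sums become [chi^mu], and the determinant becomes the
    alternant of exponents [rho + delta]. *)
Lemma schar_orthogonality rho mu : is_partition rho -> is_partition mu ->
  \sum_s schar rho s * schar mu s = d`!%:R * [forall i, rho i == mu i]%:R.
Proof.
move=> Hr Hm; have sr : (\sum_i rho i = d)%N by case/andP: Hr => /eqP.
pose alt := \det (\matrix_(i < d, j < d) var j ^+ (d.-1 - i)).
pose m := monomial [ffun i => shifted mu i].
have mcz (z : int) p : mpoly.mcoeff m (z%:~R * p) = z * mpoly.mcoeff m p.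
  by rewrite mulrzl raddfMz -mulrzl intz.
have dM : (d <= 2 * d)%N by lia.
have := congr1 (fun p => mpoly.mcoeff m (p * alt)) (sum_schar_powersum var dM sr).
rewrite mulr_suml raddf_sum/=.
under eq_bigr do rewrite -mulrA mcz coef_alternant_powersum.
move=> ->; rewrite -mulrA det_hmatrix_vandermonde//; last by move=> i; exact: shifted_le.
rewrite [X in mpoly.mcoeff m (X * _)]pmulrn mcz natz; congr (_ * _).
have Dr := shifted_decreasing Hr; have Dm := shifted_decreasing Hm.
have coefw w : mpoly.mcoeff m ((-1) ^+ odd_perm w *
    \prod_i (\matrix_(i < d, j < d) var j ^+ shifted rho i)^T i (w i)) =
    (-1) ^+ odd_perm w * [forall i, shifted rho (w i) == shifted mu i]%:R.
  rewrite (eq_bigr (fun i => var i ^+ [ffun i => shifted rho (w i)] i)) => [|i _]; last first.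
    by rewrite !mxE [in RHS]ffunE.
  have -> : [forall i, shifted rho (w i) == shifted mu i] =
      ([ffun i => shifted rho (w i)] == [ffun i => shifted mu i]).
    apply/forallP/eqP => [e|/ffunP e i].
      by apply/ffunP => i; rewrite [LHS]ffunE [RHS]ffunE (eqP (e i)).
    by have := e i; rewrite [LHS]ffunE [RHS]ffunE => ->.
  case: (odd_perm w); last by rewrite !expr0 !mul1r coef_monomial.
  by rewrite !expr1 !mulN1r raddfN /= coef_monomial.
(* Both exponent sequences strictly decrease, so only the identity can match them. *)
rewrite -det_tr raddf_sum (bigD1 1%g)//= [X in _ + X]big1 ?addr0 => [|w w1].
  rewrite coefw odd_perm1 expr0 mul1r; congr (nat_of_bool _)%:R.
  by apply: eq_forallb => i; rewrite perm1 /shifted eqn_add2r.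
rewrite coefw (_ : [forall i, _] = false) ?mulr0//.
apply: contraNF w1 => /forallP e.
by apply/eqP/(decreasing_perm Dr Dm) => i; apply/eqP.
Qed.

End Orthogonality.
End FrobeniusFormula.

(** * The content product *)

Section Multinomial.
Variable T : finType.

Lemma colcount_sum d (f : {ffun 'I_d -> T}) t : colcount f t = (\sum_x (f x == t))%N.
Proof. by rewrite ffunE -sum1dep_card big_mkcond; apply: eq_bigr => x _; case: eqP. Qed.

(** Multinomial coefficients, by induction on the letters: deleting the first letter, of colour [t],
    lowers the count of [t] by one, and the factors [a t] gained in this way add up to the number of
    letters. *)
Lemma card_colcount d (a : {ffun T -> nat}) : (\sum_t a t = d)%N ->
  (#|[set f : {ffun 'I_d -> T} | colcount f == a]| * \prod_t (a t)`! = d`!)%N.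
Proof.
elim: d a => [|d IH] a sa.
  have a0 t : a t = 0%N by apply/eqP; rewrite -leqn0 -sa (bigD1 t)//= leq_addr.
  rewrite big1 ?muln1 => [|t _]; last by rewrite a0.
  have -> : [set f : {ffun 'I_0 -> T} | colcount f == a] = finset.setT.
    apply/setP => f; rewrite !inE; apply/eqP/ffunP => t.
    by rewrite colcount_sum big_ord0 a0.
  by rewrite cardsT card_ffun card_ord expn0.
pose am t : {ffun T -> nat} := [ffun u => (a u - (u == t))%N].
pose cons (tg : T * {ffun 'I_d -> T}) : {ffun 'I_d.+1 -> T} :=
  [ffun x => if unlift ord0 x is Some y then tg.2 y else tg.1].
have cons_bij : bijective cons.
  exists (fun f : {ffun 'I_d.+1 -> T} => (f ord0, [ffun y => f (lift ord0 y)])) => [[t g]|f].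
    congr pair; first by rewrite ffunE unlift_none.
    by apply/ffunP => y; rewrite !ffunE liftK.
  by apply/ffunP => x; rewrite ffunE; case: unliftP => [y|] ->//=; rewrite ffunE.
have cons_col t g u : colcount (cons (t, g)) u = ((t == u) + colcount g u)%N.
  rewrite !colcount_sum big_ord_recl !ffunE unlift_none; congr (_ + _)%N.
  by apply: eq_bigr => y _; rewrite ffunE liftK.
rewrite -sum1dep_card (reindex cons) /=; last exact: onW_bij.
rewrite -(pair_big_dep predT (fun t g => colcount (cons (t, g)) == a) (fun _ _ => 1%N)) /=.
rewrite big_distrl /= factS -[X in (X * _)%N]sa big_distrl/=; apply: eq_bigr => t _.
rewrite sum1dep_card; have [at0|at0] := posnP (a t).
  rewrite at0 mul0n (_ : [set _ | _] = finset.set0) ?cards0//.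
  apply/setP => g; rewrite !inE; apply/negbTE/eqP => /ffunP/(_ t).
  by rewrite cons_col eqxx at0.
have amE u : a u = ((t == u) + am t u)%N.
  by rewrite ffunE [t == u]eq_sym; case: eqP => [->|_]; rewrite ?subnKC// subn0.
have sam : (\sum_u am t u = d)%N.
  apply/eqP; rewrite -eqSS -sa; apply/eqP; under [RHS]eq_bigr do rewrite amE.
  rewrite [RHS]big_split/= [X in _ = (X + _)%N](bigD1 t)//= eqxx.
  rewrite [X in _ = (1 + X + _)%N]big1 ?addn0 ?add1n// => u.
  by rewrite eq_sym => /negPf ->.
rewrite -(IH _ sam) (_ : [set g | _] = [set g | colcount g == am t]); last first.
  apply/setP => g; rewrite !inE; apply/eqP/eqP => e; apply/ffunP => u.
    by apply/eqP; rewrite -(eqn_add2l (t == u)) -cons_col e amE.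
  by rewrite cons_col e amE.
rewrite mulnCA; congr (_ * _)%N; rewrite (bigD1 t)//= [in RHS](bigD1 t)//= mulnA.
congr (_ * _)%N; first by rewrite ffunE eqxx subn1; case: (a t) at0.
by apply: eq_bigr => u ut; rewrite ffunE (negPf ut) subn0.
Qed.

End Multinomial.

Section RisingFactorials.
Variable (R : comNzRingType).

Definition rising (x : R) (m : nat) : R := \prod_(s < m) (x + s%:R).

Lemma risingD x m n : rising x (m + n) = rising x m * rising (x + m%:R) n.
Proof.
rewrite /rising big_split_ord/=; congr (_ * _).
by apply: eq_bigr => s _; rewrite natrD addrA.
Qed.

Lemma risingS x m : rising x m.+1 = rising x m * (x + m%:R).
Proof. by rewrite /rising big_ord_recr. Qed.

Lemma risingSl x m : rising x m.+1 = x * rising (x + 1) m.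
Proof.
by rewrite -add1n risingD /rising big_ord1 addr0.
Qed.

End RisingFactorials.

(** * Determinants of multiset coefficients *)

Section HookContent.
Implicit Types (x b : {poly rat}).

(** The polynomial in the number of variables [x] whose values are the complete homogeneous
    functions at [(1, .., 1)]. *)
Definition multichoose x (m : nat) : {poly rat} := (m`!%:R)^-1 *: rising x m.

Lemma fact_rat_neq0 n : (n`!%:R : rat) != 0.
Proof. by rewrite pnatr_eq0 -lt0n fact_gt0. Qed.

(** Pascal's rule, the recurrence obeyed by complete homogeneous functions when a variable equal to
    one is removed. *)
Lemma multichooseB x m :
  multichoose x m.+1 - multichoose x m = multichoose (x - 1) m.+1.
Proof.
apply: (scalerI (fact_rat_neq0 m.+1)); rewrite scalerBr /multichoose !scalerA.
rewrite !mulfV ?fact_rat_neq0// !scale1r factS natrM -mulrA mulfV ?fact_rat_neq0// mulr1.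
rewrite risingS risingSl subrK scaler_nat -[X in _ - X]mulr_natr -mulrBr mulrC; congr (_ * _).
by rewrite -addn1 natrD; ring.
Qed.

Lemma multichoose0 x : multichoose x 0 = 1.
Proof. by rewrite /multichoose /rising big_ord0 fact0 invr1 scale1r. Qed.

(** Extended by zero to negative degrees, like [hsym]. *)
Definition multichooseZ (l e : nat) x : {poly rat} :=
  if (e <= l)%N then multichoose x (l - e) else 0.

Lemma multichooseZB l e x :
  multichooseZ l e x - multichooseZ l e.+1 x = multichooseZ l e (x - 1).
Proof.
rewrite /multichooseZ; case: (ltngtP e l) => [el|le|->].
- by rewrite -(subnSK el) multichooseB.
- by rewrite subr0.
- by rewrite subnn !multichoose0 subr0.
Qed.

(** Iterating Pascal's rule, subtracting [j] from [x] is a [j]-fold difference in [e]. *)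
Lemma multichooseZ_shift l e x j :
  multichooseZ l e (x - j%:R) =
  \sum_(s < j.+1) (-1) ^+ s * 'C(j, s)%:R * multichooseZ l (e + s) x.
Proof.
elim: j e => [|j IH] e.
  by rewrite big_ord1 subr0 expr0 bin0 !mul1r addn0.
rewrite -natr1 opprD addrA -multichooseZB !IH.
rewrite big_ord_recl [in RHS]big_ord_recl [X in _ - X]big_ord_recr /=.
rewrite [X in _ = _ + X]big_ord_recr /= !bin0 !binn !expr0 !mul1r !addn0.
rewrite (eq_bigr (fun s : 'I_j => (-1) ^+ s.+1 * 'C(j, s.+1)%:R * multichooseZ l (e + s.+1) x)); last first.
  by move=> s _; rewrite /bump /= add1n.
rewrite -addrA; congr (_ + _); rewrite opprD addrA -sumrB; congr (_ + _).
  apply: eq_bigr => s _; rewrite /bump /= add1n binS natrD addSnnS exprS; ring.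
by rewrite exprS addSnnS; ring.
Qed.

Variables (d : nat) (rho : 'I_d -> nat).

Definition inv_fact_matrix : 'M[rat]_d :=
  \matrix_(i, j) if (d.-1 - j <= shifted rho i)%N
                 then ((shifted rho i - (d.-1 - j))`!%:R)^-1 else 0.

Definition multichoose_matrix : 'M[{poly rat}]_d :=
  \matrix_(i, j) multichooseZ (shifted rho i) (d.-1 - j) 'X.

(** Column operations taking iterated differences; unitriangular, since ['C(j, k)] vanishes for
    [k > j]. *)
Definition shift_matrix : 'M[{poly rat}]_d :=
  \matrix_(k, j) ((-1) ^+ (j - k) * 'C(j, k)%:R).

Lemma det_shift_matrix : \det shift_matrix = 1.
Proof.
rewrite -det_tr det_trig; last first.
  by apply/is_trig_mxP => i j ij; rewrite !mxE bin_small// mulr0.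
by rewrite big1// => i _; rewrite !mxE subnn binn expr0 mul1r.
Qed.

Lemma multichoose_shift_matrix :
  multichoose_matrix *m shift_matrix =
  \matrix_(i, j) multichooseZ (shifted rho i) (d.-1 - j) ('X - (j : nat)%:R).
Proof.
apply/matrixP => i j; rewrite !mxE multichooseZ_shift.
have jd := ltn_ord j; pose F k := (-1) ^+ (j - k) * 'C(j, k)%:R *
  multichooseZ (shifted rho i) (d.-1 - k) 'X : {poly rat}.
rewrite (eq_bigr (fun k : 'I_d => F k)); last first.
  by move=> k _; rewrite !mxE mulrC.
rewrite -(big_mkord predT F) (big_cat_nat (n := j.+1))//=.
rewrite [X in _ + X]big_nat [X in _ + X]big1 ?addr0 => [|k]; last first.
  by case/andP => jk _; rewrite /F bin_small// mulr0 mul0r.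
rewrite big_mkord (reindex_inj rev_ord_inj); apply: eq_bigr => s _ /=.
have sj : (s <= j)%N by rewrite -ltnS ltn_ord.
have e : (d.-1 - (j - s) = d.-1 - j + s)%N by move: sj jd; clear; lia.
by rewrite /F subSS (subKn sj) (bin_sub sj) e.
Qed.

(** The rising factorial of length [l] splits at [e]. Up to a factorial, an entry is thus the
    quotient of a factor in [l] by a factor in [e]. *)
Lemma multichooseZ_rising l e b :
  rising b e * multichooseZ l e (b + e%:R) =
  rising b l * (if (e <= l)%N then ((l - e)`!%:R)^-1 else 0)%:P.
Proof.
rewrite /multichooseZ; case: leqP => el; last by rewrite !mulr0.
by rewrite /multichoose -scalerAr -risingD subnKC// mulrC mul_polyC.
Qed.

Definition content_poly : {poly rat} :=
  \prod_(i < d) rising ('X - (i : nat)%:R) (rho i).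

(** After the column operations, [multichooseZ_rising] splits each entry into a row factor, a column
    factor and an inverse factorial. The row factors divided by the column factors leave the content
    product. *)
Lemma det_multichoose_matrix :
  \det multichoose_matrix = content_poly * (\det inv_fact_matrix)%:P.
Proof.
(* With this base, the argument ['X - j] of column [j] is [b] plus the exponent [d.-1 - j] of that
   column. *)
pose b : {poly rat} := 'X - (d.-1)%:R.
have b0 j : rising b j != 0.
  rewrite /rising prodf_seq_neq0; apply/allP => s _ /=.
  have -> : b + s%:R = 'X - (d.-1%:R - s%:R)%:P.
    by rewrite polyCB !polyC_natr /b; ring.
  by rewrite polyXsubC_eq0.
have bE (j : 'I_d) : 'X - (j : nat)%:R = b + (d.-1 - j)%:R.
  by rewrite /b natrB ?addrA ?subrK//; have := ltn_ord j; lia.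
have B0 : \prod_(j < d) rising b (d.-1 - j) != 0.
  by rewrite prodf_seq_neq0; apply/allP => j _ /=; apply: b0.
have -> : \det multichoose_matrix =
    \det (\matrix_(i, j) multichooseZ (shifted rho i) (d.-1 - j) ('X - (j : nat)%:R)).
  by rewrite -multichoose_shift_matrix det_mulmx det_shift_matrix mulr1.
apply: (mulfI B0).
pose D (f : 'I_d -> {poly rat}) : 'M[{poly rat}]_d := diag_mx (\row_j f j).
have detD f : \det (D f) = \prod_j f j.
  by rewrite det_diag; apply: eq_bigr => j _; rewrite mxE.
have -> : \prod_(j < d) rising b (d.-1 - j) * (content_poly * (\det inv_fact_matrix)%:P) =
   \det (D (fun i => rising b (shifted rho i)) *m map_mx polyC inv_fact_matrix).
  rewrite det_mulmx detD det_map_mx [LHS]mulrA; congr (_ * _).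
  rewrite /content_poly -big_split/=; apply: eq_bigr => i _.
  by rewrite /shifted addnC risingD bE.
rewrite -(detD (fun j => rising b (d.-1 - j))) mulrC -det_mulmx.
congr (\det _); apply/matrixP => i j; rewrite mul_mx_diag mul_diag_mx !mxE.
by rewrite mulrC bE multichooseZ_rising.
Qed.

Variable N : nat.

(** The generating function is [1 / (1 - X) ^ N] up to degree [M]. Multiplying it by [1 - X] lowers
    [N], which on coefficients is Pascal's rule. *)
Lemma coef_hgen1 M m : (m <= M)%N ->
  (hgen M (fun _ : 'I_N => 1 : rat))`_m = (multichoose 'X m).[N%:R].
Proof.
rewrite /hgen prodr_const card_ord; elim: N m => [|n IH] m mM.
  rewrite expr0 coef1; case: m {mM} => [|m]; first by rewrite multichoose0 hornerE.
  by rewrite /multichoose risingSl hornerZ hornerM hornerX mul0r mulr0.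
elim: m mM => [|m IHm] mM.
  rewrite multichoose0 hornerE exprS coefM big_ord1 IH// multichoose0 hornerE mulr1.
  rewrite coef_sum big_ord_recl big1 => [|k _]; first by rewrite expr1n coefZ coefXn mulr1 addr0.
  by rewrite coefZ coefXn mulr0.
rewrite -[LHS](subrK ((\sum_(a < M.+1) 1 ^+ a *: 'X^a) ^+ n.+1)`_m).
rewrite (IHm (ltnW mM)) -[RHS](subrK (multichoose 'X m).[n.+1%:R]); congr (_ + _).
rewrite -hornerN -hornerD multichooseB hornerN -(IHm (ltnW mM)).
set g : {poly rat} := \sum_(a < _) _.
have -> : (g ^+ n.+1)`_m.+1 - (g ^+ n.+1)`_m = (g ^+ n.+1 * (1 - 1 *: 'X))`_m.+1.
  by rewrite scale1r mulrBr mulr1 coefB coefMX.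
rewrite exprSr -mulrA geometric_trunc expr1n scale1r mulrBr mulr1 coefB coefMXn.
rewrite ltnS mM subr0 IH// /multichoose !hornerZ; congr (_ * _).
rewrite /rising !horner_prod; apply: eq_bigr => s _; rewrite !hornerE.
by rewrite -natr1 -!polyC_natr !hornerE addrK.
Qed.

End HookContent.

(** * Characters *)

Section ContentFormula.
Variables (d : nat).
Implicit Types (rho : 'I_d -> nat) (s : 'S_d).

(** Frobenius' degree formula: the identity fixes every colouring, so the counts are multinomial
    coefficients and the alternating sum is a Leibniz expansion. *)
Lemma schar1 rho : (\sum_i rho i = d)%N ->
  (schar rho 1)%:~R = d`!%:R * \det (inv_fact_matrix rho).
Proof.
move=> sr; rewrite scharE rmorph_sum big_distrr/=; apply: eq_bigr => w _.
rewrite rmorphM rmorph_sign natz mulrCA; congr (_ * _).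
rewrite (ncolcount_ext _ (shift_predE rho w)); case: ifPn => H; last first.
  rewrite ncolcount0//; move: H => /forallPn [i Hi].
  by rewrite (bigD1 i)//= mxE (negPf Hi) mul0r mulr0.
rewrite -(card_colcount (sum_shift_content sr H)) natrM.
rewrite (_ : ncolcount _ _ = #|[set f : {ffun 'I_d -> 'I_d} | colcount f == shift_content rho w]|); last first.
  by rewrite /ncolcount; apply: eq_card => f; rewrite !inE recolor1 eqxx.
rewrite -mulrA natr_prod -big_split/= big1 ?mulr1// => i _.
by rewrite !mxE (forallP H) ffunE mulfV ?fact_rat_neq0.
Qed.

(** This is [N ^ #cycles s], the trace of the permutation operator of [s]. *)
Definition numfix (N : nat) s : nat :=
  #|[set f : {ffun 'I_d -> 'I_N} | recolor f s == f]|.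

Lemma powersum1 (R : comNzRingType) N s :
  powersum (fun _ : 'I_N => 1 : R) s = (numfix N s)%:R.
Proof.
rewrite /numfix -sum1dep_card natr_sum; apply: eq_bigr => f _.
by rewrite big1.
Qed.

(** The Jacobi-Trudi determinant at [N] variables equal to one is the content product times the
    determinant that gives the degree. *)
Lemma sum_schar_numfix rho N : is_partition rho ->
  \sum_s schar rho s * (numfix N s)%:Z = Crho rho N * schar rho 1.
Proof.
move=> Hr; have sr : (\sum_i rho i = d)%N by case/andP: Hr => /eqP.
apply/eqP; rewrite -(eqr_int rat); apply/eqP; rewrite rmorph_sum rmorphM/= schar1//.
under eq_bigr do rewrite rmorphM/= -pmulrn -powersum1.
rewrite (@sum_schar_powersum _ _ _ (2 * d)) ?leq_pmull//; rewrite [RHS]mulrCA; congr (_ * _).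
have -> : hmatrix (2 * d) (fun _ : 'I_N => 1) rho =
    map_mx (horner_eval N%:R) (multichoose_matrix rho).
  apply/matrixP => i j; rewrite !mxE /horner_eval /hsym /multichooseZ.
  case: ifP => _; last by rewrite horner0.
  by rewrite coef_hgen1// (leq_trans (leq_subr _ _))// shifted_le.
rewrite det_map_mx det_multichoose_matrix rmorphM/= /horner_eval hornerC.
congr (_ * _); rewrite /content_poly /Crho horner_prod rmorph_prod/=.
apply: eq_bigr => i _; rewrite /rising horner_prod rmorph_prod/=.
apply: eq_bigr => j _; rewrite -!polyC_natr !hornerE rmorphB rmorphD/=.
by rewrite addrAC -!pmulrn.
Qed.

End ContentFormula.

(** * Representations on colourings and convolution *)

Section Characters.
Variables (d : nat).
Implicit Types (s t : 'S_d).

Section ColouringRepresentation.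
Variables (T : finType) (P : pred {ffun T -> nat}).

Let X := {f : {ffun 'I_d -> T} | P (colcount f)}.

(** Matrices act on rows from the right while recolouring is a left action, hence the inverse. *)
Definition colouring_mx s : 'M[algC]_#|{: X}| :=
  \matrix_(a, b) (val (enum_val b) == recolor (val (enum_val a)) s^-1)%:R.

Lemma colouring_mx_repr : mx_repr [set: 'S_d] colouring_mx.
Proof.
split=> [|s t _ _].
  apply/matrixP => a b; rewrite !mxE invg1 recolor1 (inj_eq val_inj).
  by rewrite (inj_eq enum_val_inj) eq_sym.
apply/matrixP => a b; rewrite !mxE.
have PX : P (colcount (recolor (val (enum_val a)) s^-1)).
  by rewrite colcount_recolor (valP (enum_val a)).
rewrite (bigD1 (enum_rank (Sub _ PX : X)))//= !mxE enum_rankK SubK eqxx mul1r.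
rewrite invMg recolorM big1 ?addr0// => c ca; rewrite !mxE.
rewrite (_ : (_ == recolor _ s^-1) = false) ?mul0r//; apply: contraNF ca => /eqP e.
by apply/eqP/enum_val_inj; rewrite enum_rankK; apply/val_inj; rewrite SubK.
Qed.

Definition colouring_repr := MxRepresentation colouring_mx_repr.

Lemma cfRepr_colouring s : cfRepr colouring_repr s = (ncolcount P s)%:R.
Proof.
rewrite cfunE inE mulr1n /mxtrace /ncolcount.
under eq_bigr do rewrite mxE.
rewrite (reindex enum_rank); last exact: onW_bij (enum_rank_bij _).
under eq_bigr do rewrite enum_rankK.
rewrite -natr_sum -sum1dep_card big_mkcondl; congr _%:R.
rewrite [RHS](reindex_omap (val : X -> _) insub) => [|f Pf]; last first.
  by rewrite insubT.
apply: eq_big => [x|x _]; first by rewrite (valP x) valK eqxx.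
rewrite -[in RHS](inj_eq (@recolor_inj _ _ s^-1)) -recolorM mulVg recolor1.
by case: eqP.
Qed.

End ColouringRepresentation.

Definition schar_cfun (rho : 'I_d -> nat) : 'CF([set: 'S_d]) :=
  \sum_w (-1) ^+ odd_perm w *: cfRepr (colouring_repr (shift_pred rho w)).

Lemma schar_cfunE rho s : schar_cfun rho s = (schar rho s)%:~R.
Proof.
rewrite sum_cfunE scharE rmorph_sum/=; apply: eq_bigr => w _.
by rewrite cfunE cfRepr_colouring rmorphM rmorph_sign rmorph_nat.
Qed.

Lemma schar_cfun_vchar rho : schar_cfun rho \in 'Z[irr [set: 'S_d]]%g.
Proof.
apply: rpred_sum => w _; rewrite rpredZsign.
by apply: char_vchar; apply: cfRepr_char.
Qed.

Lemma schar_inv rho s : schar rho s^-1 = schar rho s.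
Proof.
rewrite !scharE; apply: eq_bigr => w _; congr (_ * _%:R).
rewrite /ncolcount; apply: eq_card => f; rewrite !inE; congr (_ && _).
by rewrite -(inj_eq (@recolor_inj _ _ s)) -recolorM mulgV recolor1 eq_sym.
Qed.

Lemma schar_cfun_norm rho : is_partition rho -> '[schar_cfun rho] = 1.
Proof.
move=> Hr; rewrite cfdotE cardsT card_Sn.
under eq_bigr do rewrite !schar_cfunE rmorph_int -rmorphM/=.
rewrite -rmorph_sum/= (eq_bigl predT) => [|s]; last by rewrite inE.
rewrite schar_orthogonality// (_ : [forall i, _]) ?mulr1; last by apply/forallP.
by rewrite rmorph_nat mulVf// pnatr_eq0 -lt0n fact_gt0.
Qed.

(** A virtual character of norm one is irreducible up to sign; the sign need not be known, as it
    cancels in the convolution formula. *)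
Lemma schar_irr rho : is_partition rho ->
  exists (e : bool) (i : Iirr [set: 'S_d]),
    forall s, (schar rho s)%:~R = (-1) ^+ e * 'chi_i s.
Proof.
move=> Hr; have [e [i E]] := vchar_norm1P (schar_cfun_vchar rho) (schar_cfun_norm Hr).
by exists e, i => s; rewrite -schar_cfunE E cfunE.
Qed.

Lemma numfixE N s : numfix N s = ncolcount (T := 'I_N) predT s.
Proof. by apply: eq_card => f; rewrite !inE andbT. Qed.

Lemma numfix_inv N s : numfix N s^-1 = numfix N s.
Proof.
apply: eq_card => f; rewrite !inE.
by rewrite -(inj_eq (@recolor_inj _ _ s)) -recolorM mulgV recolor1 eq_sym.
Qed.

(** Expanding the class function [G] in irreducible characters, the generalized orthogonality
    relation keeps only the component along ['chi_i]. *)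
Lemma chi_convolution (G : 'CF([set: 'S_d])) i s :
  \sum_t 'chi_i (s * t)%g * G t^-1%g =
  d`!%:R * '[G, 'chi_i] * ('chi_i s / 'chi_i 1%g).
Proof.
have orth j : \sum_t 'chi_i (s * t)%g * ('[G, 'chi_j] * 'chi_j t^-1%g) =
    (i == j)%:R * (d`!%:R * '[G, 'chi_j] * ('chi_i s / 'chi_i 1%g)).
  have := generalized_orthogonality_relation s i j.
  rewrite cardsT card_Sn (eq_bigl predT) => [H|t]; last by rewrite inE.
  have d0 : (d`!%:R : algC) != 0 by rewrite pnatr_eq0 -lt0n fact_gt0.
  rewrite mulrCA -H; set S := \sum_t _ in H *.
  rewrite (_ : d`!%:R * _ * _ = '[G, 'chi_j] * S); last by rewrite mulrAC mulVKf// mulrC.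
  rewrite big_distrr/=; apply: eq_bigr => t _; rewrite mulrCA; congr (_ * (_ * _)).
  (* A class function takes the same value at [s * t] and [t * s]. *)
  by rewrite -(cfunJ 'chi_i (s * t)%g (finset.in_setT s)) conjgE mulgA mulKg.
under eq_bigr => t _ do rewrite {1}[G]cfun_sum_cfdot sum_cfunE big_distrr/=.
rewrite exchange_big/= (bigD1 i)//= [X in _ + X]big1 ?addr0 => [|j ji].
  under eq_bigr do rewrite cfunE.
  by rewrite orth eqxx mul1r.
under eq_bigr do rewrite cfunE.
by rewrite orth eq_sym (negPf ji) mul0r.
Qed.

(** Convolution with the class function [numfix] multiplies an irreducible character by a scalar,
    which the case [s = 1] identifies as [Crho rho N]. *)
Lemma schar_conv rho (N : nat) s : is_partition rho ->
  \sum_t schar rho (s * t) * (numfix N t)%:Z = Crho rho N * schar rho s.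
Proof.
move=> Hr; pose G := cfRepr (colouring_repr (T := 'I_N) predT).
have GE t : G t^-1%g = ((numfix N t)%:Z)%:~R.
  by rewrite cfRepr_colouring -numfixE numfix_inv -pmulrn.
have [e [i E]] := schar_irr Hr.
have conv u : (\sum_t schar rho (u * t) * (numfix N t)%:Z)%:~R =
    (-1) ^+ e * (d`!%:R * '[G, 'chi_i] * ('chi_i u / 'chi_i 1%g)).
  rewrite -chi_convolution rmorph_sum big_distrr/=; apply: eq_bigr => t _.
  by rewrite rmorphM/= E GE mulrA.
have /eqP := conv 1%g; under eq_bigr do rewrite mul1g.
rewrite sum_schar_numfix// rmorphM/= E divff ?irr1_neq0// mulr1 mulrCA.
have e0 : (-1) ^+ e != 0 :> algC by rewrite signr_eq0.
rewrite (inj_eq (mulfI e0)) => /eqP C.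
apply/eqP; rewrite -(eqr_int algC) conv -C rmorphM/= E; apply/eqP.
by have c0 := irr1_neq0 i; field.
Qed.

End Characters.

(** * Completeness and column orthogonality *)

Section Completeness.
Variable (d : nat).
Implicit Types (rho : 'I_d -> nat) (s w : 'S_d) (al : {ffun 'I_d -> nat}).

Lemma ncolcount_perm al w s :
  ncolcount (pred1 [ffun i => al (w i)]) s = ncolcount (pred1 al) s.
Proof.
pose h (f : {ffun 'I_d -> 'I_d}) := [ffun x => w (f x)].
have hinj : injective h.
  by move=> f g /ffunP e; apply/ffunP => x; have := e x; rewrite !ffunE => /perm_inj.
have hV (f : {ffun 'I_d -> 'I_d}) : h [ffun x => w^-1 (f x)]%g = f.
  by apply/ffunP => x; rewrite !ffunE permKV.
have hc f i : colcount (h f) (w i) = colcount f i.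
  by rewrite !colcount_sum; apply: eq_bigr => x _; rewrite ffunE (inj_eq perm_inj).
have hr f t : recolor (h f) t = h (recolor f t) by apply/ffunP => x; rewrite !ffunE.
rewrite /ncolcount -[LHS](card_imset _ hinj); apply: eq_card => f.
apply/imsetP/idP => [[g]|]; rewrite !inE.
  move=> /andP[/eqP gs /eqP/ffunP gc] ->; rewrite hr gs eqxx /=.
  by apply/eqP/ffunP => i; rewrite -(permKV w i) hc gc ffunE.
move=> /andP[/eqP fs /eqP fc]; exists [ffun x => w^-1 (f x)]%g; last by rewrite hV.
rewrite inE -(inj_eq hinj) -hr !hV fs eqxx /=.
by apply/eqP/ffunP => i; rewrite -hc hV fc [RHS]ffunE.
Qed.

Lemma sort_composition al : (\sum_i al i = d)%N ->
  exists w, is_partition (fun i => al (w i)).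
Proof.
move=> sal; pose t := [tuple al i | i < d].
have : perm_eq (sort geq t) t by rewrite perm_sort.
move=> /tuple_permP[w sw]; exists w; rewrite /is_partition.
rewrite -(reindex_inj (@perm_inj _ w) (P := predT) (F := fun i => al i)) sal eqxx /=.
have nthE (i : 'I_d) : nth 0%N (sort geq t) i = al (w i).
  by rewrite sw -tnth_nth !tnth_mktuple.
apply/forallP => i; apply/forallP => j; apply/implyP => ij; rewrite -!nthE.
have tr : transitive geq by move=> a b c /= ab ca; exact: leq_trans ca ab.
have srt : sorted geq (sort geq t) by apply: sort_sorted => a b; exact: leq_total.
apply: (sorted_leq_nth tr _ 0%N srt) => //.
- exact: leqnn.
- by rewrite inE size_sort size_tuple.
- by rewrite inE size_sort size_tuple.
Qed.

Lemma sum_ltn_ord (m : nat) : (m <= d)%N -> (\sum_(k < d) (k < m))%N = m.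
Proof.
move=> md; rewrite -{2}[m]card_ord -sum1_card.
rewrite -(big_ord_narrow (F := fun=> 1%N) md) [RHS]big_mkcond.
by apply: eq_bigr => k _; case: ifP.
Qed.

(* Rearrangement inequality, obtained by comparing the contributions of each
   pair of indices, since [w i] counts the [j] with [w j < w i]. *)
Lemma rearrangement rho w : is_partition rho ->
  (\sum_i rho i * i <= \sum_i rho i * w i)%N.
Proof.
move=> /andP[_ /forallP H].
have E u : (2 * \sum_i rho i * (u : 'S_d) i =
    \sum_i \sum_j (rho i * (u j < u i) + rho j * (u i < u j)))%N.
  under [RHS]eq_bigr do rewrite big_split/=.
  rewrite big_split/= [X in (_ + X)%N]exchange_big/= addnn -mul2n; congr (2 * _)%N.
  apply: eq_bigr => i _; rewrite -big_distrr/=; congr (_ * _)%N.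
  rewrite -(reindex_inj (@perm_inj _ u) (P := predT) (F := fun k : 'I_d => (k < u i)%N : nat)).
  by rewrite sum_ltn_ord// ltnW.
rewrite -(leq_pmul2l (isT : 0 < 2)%N) E.
have := E 1%g; under eq_bigr do rewrite perm1.
move=> ->; apply: leq_sum => i _; apply: leq_sum => j _; rewrite !perm1.
have Hij := implyP (forallP (H i) j); have Hji := implyP (forallP (H j) i).
have uij : (w i : nat) = w j -> (i : nat) = j by move=> /val_inj/perm_inj ->.
case: (ltngtP i j) Hij Hji uij => [ij|ij|ij] Hij Hji uij; last by rewrite (val_inj ij) !muln0.
  move: (Hij isT) uij; case: (ltnP (w j) (w i)); case: (ltnP (w i) (w j)) => /=; lia.
move: (Hji isT) uij; case: (ltnP (w j) (w i)); case: (ltnP (w i) (w j)) => /=; lia.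
Qed.

(** The counts are [rho i + w i - i]. In the sum of their squares, the rearrangement inequality
    makes the cross terms nonnegative, and the squares of [w i - i] are not all zero. *)
Lemma sum_sqr_shift_content rho w : is_partition rho -> w != 1%g ->
  [forall i, (d.-1 - w i <= shifted rho i)%N] ->
  (\sum_i rho i ^ 2 < \sum_i shift_content rho w i ^ 2)%N.
Proof.
move=> Hr w1 /forallP H; have R := rearrangement w Hr.
(* In [nat] one of the two truncated differences is zero, so the last two squares together are the
   square of the integer [w i - i]. *)
have E (i : 'I_d) : (shift_content rho w i ^ 2 + 2 * (rho i * i) =
    rho i ^ 2 + 2 * (rho i * w i) + (w i - i) ^ 2 + (i - w i) ^ 2)%N.
  have := H i; rewrite ffunE /shifted; have := ltn_ord i; have := ltn_ord (w i).
  move: (rho i) (nat_of_ord i) (nat_of_ord (w i)) => r a b bd ad h.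
  have -> : (r + (d.-1 - a) - (d.-1 - b) = r + b - a)%N by move: h; lia.
  have h' : (a <= r + b)%N by move: h; lia.
  clear h; case: (leqP a b) => ab.
    rewrite -{}(subnKC ab); move: (b - a)%N => c.
    have -> : (r + (a + c) - a = r + c)%N by lia.
    have -> : (a - (a + c) = 0)%N by lia.
    by rewrite addKn -!mulnn; ring.
  have e : (r = (a - b) + (r + b - a))%N by move: ab h'; lia.
  have ae : a = (b + (a - b))%N by move: ab; lia.
  move: (r + b - a)%N (a - b)%N e ae => c g -> ->.
  have -> : (b - (b + g) = 0)%N by lia.
  by rewrite -!mulnn; ring.
have [i wi] : exists i, w i != i.
  apply/existsP; apply: contraR w1; rewrite negb_exists => /forallP wi.
  by apply/eqP/permP => i; rewrite perm1; apply/eqP; have := wi i; rewrite negbK.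
have pos : (0 < \sum_(i < d) (w i - i) ^ 2 + \sum_(i < d) (i - w i) ^ 2)%N.
  rewrite -big_split/= (bigD1 i)//= ltn_addr// addn_gt0 !expn_gt0 !subn_gt0 !orbF.
  by rewrite -neq_ltn eq_sym.
have : (\sum_i (shift_content rho w i ^ 2 + 2 * (rho i * i)) =
  \sum_i (rho i ^ 2 + 2 * (rho i * w i) + (w i - i) ^ 2 + (i - w i) ^ 2))%N.
  by apply: eq_bigr => j _; exact: E.
rewrite !big_split/= !big1_eq; move: R pos.
move: (\sum_i rho i * i)%N (\sum_i rho i * w i)%N => a b.
move: (\sum_(i < d) (w i - i) ^ 2)%N (\sum_(i < d) (i - w i) ^ 2)%N => u v.
move: (\sum_i rho i ^ 2)%N (\sum_i shift_content rho w i ^ 2)%N => x y; clear.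
by lia.
Qed.

Lemma sum_sqr_le al : (\sum_i al i = d)%N -> (\sum_i al i ^ 2 <= d ^ 2)%N.
Proof.
move=> sal; rewrite -[X in (_ <= X ^ 2)%N]sal -mulnn big_distrl/= leq_sum// => i _.
by rewrite -mulnn leq_mul2l (bigD1 i)//= leq_addr orbT.
Qed.

(** Induction upwards on the sum of squares of [al]. In the expansion of [chi^rho], for [rho] the
    sorted [al], the term [w = 1] is the permutation character of [al]; any other nonzero term has
    counts with a larger sum of squares. *)
Lemma schar_complete (phi : 'S_d -> int) :
  (forall rho, is_partition rho -> \sum_s phi s * schar rho s = 0) ->
  forall al, (\sum_i al i = d)%N ->
  \sum_s phi s * (ncolcount (pred1 al) s)%:Z = 0.
Proof.
move=> H al sal.
have [m] := ubnP (d ^ 2 - \sum_i al i ^ 2)%N; elim: m al sal => // m IH al sal.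
rewrite ltnS => lm; have [u Hu] := sort_composition sal.
pose rho i := al (u i).
have sr : (\sum_i rho i = d)%N by case/andP: Hu => /eqP.
have sqr : (\sum_i al i ^ 2 = \sum_i rho i ^ 2)%N.
  by rewrite (reindex_inj (@perm_inj _ u)).
have := H rho Hu; under eq_bigr do rewrite scharE big_distrr/=.
rewrite exchange_big (bigD1 1%g)//= [X in _ + X]big1 ?addr0 => [H1|w w1].
  rewrite -[RHS]H1; apply: eq_bigr => s _; rewrite odd_perm1 expr0 mul1r -natz; congr (_ * _%:R).
  rewrite -(ncolcount_perm al u) (ncolcount_ext _ (shift_predE rho 1)).
  rewrite ifT; last by apply/forallP => i; rewrite perm1 leq_addl.
  apply: ncolcount_ext => c /=; congr (c == _).
  by apply/ffunP => i; rewrite !ffunE perm1 /shifted addnK.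
under eq_bigr do rewrite mulrCA (ncolcount_ext _ (shift_predE rho w)).
rewrite -big_distrr/=; case: ifPn => [Hw|_]; last first.
  by rewrite big1 ?mulr0// => s _; rewrite ncolcount0// mulr0.
under eq_bigr do rewrite natz.
have scs := sum_shift_content sr Hw.
rewrite IH ?mulr0//; have := sum_sqr_shift_content Hu w1 Hw.
have := sum_sqr_le scs.
by rewrite -/rho -sqr; move: lm; lia.
Qed.

(** The counts [(1, .., 1)] give the regular character, as an injective colouring is fixed only by
    the identity. *)
Lemma ncolcount_ones s :
  ncolcount (pred1 [ffun _ : 'I_d => 1%N]) s = (d`! * (s == 1%g))%N.
Proof.
have := @card_colcount 'I_d d [ffun=> 1%N]; under eq_bigr do rewrite ffunE.
rewrite sum1_card card_ord => /(_ erefl).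
rewrite big1 ?muln1 => [<-|i _]; last by rewrite ffunE.
case: eqP => [->|s1]; rewrite /ncolcount.
  by rewrite muln1; apply: eq_card => f; rewrite !inE recolor1 eqxx.
rewrite muln0; apply: eq_card0 => f; rewrite !inE; apply/negP.
move=> /andP[/eqP/ffunP fs /eqP/ffunP f1]; apply: s1; apply/permP => x; rewrite perm1.
apply/eqP; apply: contraT => sx; have := f1 (f x).
have := fs x; rewrite [LHS]ffunE => fsx.
rewrite colcount_sum ffunE (bigD1 x)//= (bigD1 (s x))//=.
by rewrite fsx !eqxx.
Qed.

(** The difference [phi] of the two sides is orthogonal to every [chi^rho], hence by completeness to
    the permutation characters. It vanishes because its norm does. *)
Lemma schar_sum s :
  \sum_(rho : {ffun 'I_d -> 'I_d.+1} | is_partition (fun i => nat_of_ord (rho i)))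
    schar (fun i => nat_of_ord (rho i)) 1 * schar (fun i => nat_of_ord (rho i)) s =
  (d`! * (s == 1%g))%:Z.
Proof.
pose X (rho : {ffun 'I_d -> 'I_d.+1}) : 'S_d -> int := schar (fun i => nat_of_ord (rho i)).
pose Pt (rho : {ffun 'I_d -> 'I_d.+1}) := is_partition (fun i => nat_of_ord (rho i)).
pose phi (t : 'S_d) : int := (d`! * (t == 1%g))%:Z - \sum_(rho | Pt rho) X rho 1%g * X rho t.
suff phi0 : phi s = 0 by apply/esym/eqP; rewrite -subr_eq0 -/(phi s) phi0.
have dE (f : 'S_d -> int) : \sum_t (d`! * (t == 1%g))%:Z * f t = d`!%:Z * f 1%g.
  rewrite (bigD1 1%g)//= eqxx muln1 big1 ?addr0// => t /negPf ->.
  by rewrite muln0 mul0r.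
have orth rho : is_partition rho -> \sum_t phi t * schar rho t = 0.
  move=> Hr; under eq_bigr do rewrite mulrBl mulr_suml.
  rewrite sumrB dE exchange_big/=.
  pose r0 : {ffun 'I_d -> 'I_d.+1} := [ffun i => inord (rho i)].
  have r0E i : r0 i = rho i :> nat.
    rewrite ffunE inordK// ltnS; case/andP: Hr => /eqP sr _.
    by rewrite -[X in (_ <= X)%N]sr (bigD1 i)//= leq_addr.
  have r0F : (fun i => nat_of_ord (r0 i)) = rho by apply/funext => i; exact: r0E.
  rewrite (bigD1 r0)/=; last by rewrite /Pt r0F.
  have oE mu : Pt mu -> \sum_t X mu 1%g * X mu t * schar rho t =
      X mu 1%g * (d`!%:R * [forall i, nat_of_ord (mu i) == rho i]%:R).
    by move=> Hm; rewrite -(schar_orthogonality Hm Hr) big_distrr/=; apply: eq_bigr => t _; rewrite mulrA.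
  rewrite oE; last by rewrite /Pt r0F.
  rewrite big1 ?addr0 => [|mu /andP[Hm mr0]].
    rewrite (_ : [forall i, _]); last by apply/forallP => i; rewrite r0E.
    by rewrite mulr1 /X r0F natz mulrC subrr.
  rewrite oE// (_ : [forall i, _] = false) ?mulr0//.
  apply: contraNF mr0 => /forallP e; apply/eqP/ffunP => i; apply/val_inj.
  by rewrite /= r0E (eqP (e i)).
(* Orthogonality to the regular character, which is supported at the identity. *)
have phi1 : phi 1%g = 0.
  have := schar_complete orth (al := [ffun=> 1%N]).
  under eq_bigr do rewrite ffunE; rewrite sum1_card card_ord => /(_ erefl).
  under eq_bigr do rewrite ncolcount_ones mulrC.
  rewrite dE => /eqP; rewrite mulf_eq0 => /orP[|/eqP//].
  by rewrite eqz_nat -leqn0 leqNgt fact_gt0.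
(* In one factor [phi] is expanded: its part at the identity pairs to a multiple of [phi 1], its
   characters pair to zero. *)
have : \sum_t phi t * phi t = 0.
  under eq_bigr do rewrite {1}/phi mulrBl mulr_suml.
  rewrite sumrB dE phi1 mulr0 exchange_big/= big1 ?subr0// => rho Hr.
  under eq_bigr do rewrite -mulrA [X rho _ * phi _]mulrC.
  by rewrite -big_distrr/= orth// mulr0.
move=> /eqP; rewrite psumr_eq0 => [/allP/(_ s)|t _]; last by rewrite -expr2 sqr_ge0.
by rewrite mem_index_enum mulf_eq0 orbb => /(_ isT)/eqP.
Qed.

End Completeness.

(** * The commutant of the tensor powers *)

Section Projection.
Variables (F : numFieldType) (N d : nat).
Implicit Types (s t : 'S_d) (rho : 'I_d -> nat).
Local Notation index := {ffun 'I_d -> 'I_N}.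
Implicit Types (i j a b c k : index).

Lemma recolor_eq c s t : (recolor c s == recolor c t) = (recolor c (t^-1 * s)%g == c).
Proof. by rewrite recolorM -[in RHS](inj_eq (@recolor_inj _ _ t)) -recolorM mulgV recolor1. Qed.

(* The sum over [c] and [a] of the squares is a combination of the values of
   [schar_conv], all multiples of [Crho rho N]. *)
Lemma schar_kernel_eq0 rho c a : is_partition rho -> Crho rho N = 0 ->
  \sum_s schar rho s^-1%g * (recolor c s == a)%:R = 0.
Proof.
move=> Hr C0; pose Y c a : int := \sum_s schar rho s^-1%g * (recolor c s == a)%:R.
have : \sum_(c : index) \sum_(a : index) Y c a ^+ 2 = 0.
  transitivity (\sum_(c : index) \sum_s \sum_t
      schar rho s * schar rho t * (recolor c (t^-1 * s)%g == c)%:R).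
    apply: eq_bigr => {}c _; rewrite /Y.
    under eq_bigr do rewrite expr2 mulr_suml.
    rewrite exchange_big/=; apply: eq_bigr => s _.
    under eq_bigr do rewrite big_distrr/=.
    rewrite exchange_big/=; apply: eq_bigr => t _; rewrite !schar_inv.
    rewrite (bigD1 (recolor c s))//= big1 ?addr0 => [|b /negPf bs].
      by rewrite eqxx mulr1 [_ == recolor c s]eq_sym recolor_eq mulrA.
    by rewrite eq_sym bs mulr0 mul0r.
  rewrite exchange_big/=; under eq_bigr do rewrite exchange_big/=.
  rewrite exchange_big/= big1// => t _.
  transitivity (schar rho t * \sum_s schar rho s * (numfix N (t^-1 * s)%g)%:Z).
    rewrite big_distrr/=; apply: eq_bigr => s _.
    rewrite -big_distrr/= mulrCA mulrA; congr (_ * _).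
    by rewrite /numfix -sum1dep_card -natz natr_sum [RHS]big_mkcond; apply: eq_bigr => {}c _; case: eqP.
  rewrite (reindex_inj (@mulgI _ t))/=; under eq_bigr do rewrite mulKg.
  by rewrite schar_conv// C0 mul0r mulr0.
move=> /eqP; rewrite psumr_eq0 => [/allP/(_ c)|? _]; last by apply: sumr_ge0 => ? _; exact: sqr_ge0.
rewrite mem_index_enum => /(_ isT); rewrite psumr_eq0 => [/allP/(_ a)|? _]; last exact: sqr_ge0.
by rewrite mem_index_enum => /(_ isT); rewrite sqrf_eq0 => /eqP.
Qed.

(** The convolution formula cancels the denominators [Crho], and column orthogonality then leaves
    only [s = 1]. *)
Lemma Wg_numfix c a :
  \sum_s \sum_t Wg F N (s^-1 * t)%g * (numfix N t)%:R * (recolor c s == a)%:R =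
  (c == a)%:R.
Proof.
pose X (rho : {ffun 'I_d -> 'I_d.+1}) : 'S_d -> int := schar (fun x => nat_of_ord (rho x)).
pose Pt (rho : {ffun 'I_d -> 'I_d.+1}) := is_partition (fun x => nat_of_ord (rho x)).
pose Cr (rho : {ffun 'I_d -> 'I_d.+1}) := Crho (fun x => nat_of_ord (rho x)) N.
have d0 : d`!%:R != 0 :> F by rewrite pnatr_eq0 -lt0n fact_gt0.
have conv s : \sum_t Wg F N (s^-1 * t)%g * (numfix N t)%:R =
    d`!%:R^-1 * \sum_(rho | Pt rho && (Cr rho != 0)) (X rho 1%g * X rho s^-1%g)%:~R.
  rewrite /Wg -/Pt; under eq_bigr do rewrite -mulrA mulr_suml.
  rewrite -big_distrr exchange_big/=; congr (_ * _); apply: eq_bigr => rho /andP[Hr C0].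
  rewrite rmorphM/= -/(X rho 1%g).
  under eq_bigr do rewrite -!mulrA [_^-1 * _]mulrC.
  rewrite -big_distrr/=; congr (_ * _).
  under eq_bigr do rewrite mulrA; rewrite -mulr_suml.
  apply: (canLR (mulfK _)); first by rewrite intr_eq0.
  have /(congr1 (fun z : int => z%:~R : F)) := schar_conv N s^-1%g Hr.
  by rewrite rmorph_sum rmorphM/= mulrC => <-; apply: eq_bigr => t _; rewrite rmorphM/= pmulrn.
under eq_bigr do rewrite -mulr_suml conv -mulrA mulr_suml.
rewrite -big_distrr exchange_big/=.
(* The partitions with [Crho] zero, absent from [Wg], are put back: by [schar_kernel_eq0] they act
   as zero on multi-indices. *)
transitivity (d`!%:R^-1 * (\sum_(rho | Pt rho) \sum_s
    (X rho 1%g * X rho s^-1%g)%:~R * (recolor c s == a)%:R) : F).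
  congr (_ * _); rewrite big_mkcondr; apply: eq_bigr => rho Hr; case: ifPn => //.
  rewrite negbK => /eqP C0.
  have /(congr1 (fun z : int => (X rho 1%g * z)%:~R : F)) := schar_kernel_eq0 c a Hr C0.
  rewrite mulr0 mulr0z big_distrr rmorph_sum/= => H0; rewrite -[LHS]H0; apply: eq_bigr => s _.
  by rewrite mulrA [LHS]rmorphM/= rmorph_nat.
rewrite exchange_big/=; apply: (canLR (mulKf d0)).
rewrite (bigD1 1%g)//= [X in _ + X]big1 ?addr0 => [|s s1].
  by rewrite -mulr_suml -rmorph_sum/= schar_sum invg1 eqxx muln1 recolor1 -pmulrn.
by rewrite -mulr_suml -rmorph_sum/= schar_sum invg_eq1 (negPf s1) muln0 mul0r.
Qed.

Definition kcomm (A B : index -> index -> F) : Prop :=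
  forall i j, \sum_k A i k * B k j = \sum_k B i k * A k j.

(** Commutation with the permutation operators, kernels being matrices indexed by multi-indices. *)
Definition kinvariant (T : index -> index -> F) : Prop :=
  forall s i j, T (recolor i s) (recolor j s) = T i j.

(* Double commutant: [X |-> \sum_(s, t) Wg (s^-1 t) tr(X t^-1) s] is the
   orthogonal projection onto the span of the permutation operators. It fixes
   the identity by [Wg_numfix] and commutes with right multiplication by
   permutation operators, so its components [T k] commute with [A]; hence it
   maps [A] to itself. *)
Lemma Wg_commutant (A : index -> index -> F) :
  (forall T, kinvariant T -> kcomm A T) ->
  forall i j, A i j =
    \sum_s \sum_t Wg F N (s^-1 * t)%g * (\sum_k A k (recolor k t)) *
      (recolor i s == j)%:R.
Proof.
move=> HA i j; pose T k a b : F :=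
  \sum_s \sum_t Wg F N (s^-1 * t)%g * (recolor k t == a)%:R * (recolor i s == b)%:R.
have Tinv k : kinvariant (T k).
  move=> u a b; rewrite /T (reindex_inj (@mulgI _ u))/=; apply: eq_bigr => s _.
  rewrite (reindex_inj (@mulgI _ u))/=; apply: eq_bigr => t _.
  by rewrite invMg -mulgA mulKg !recolorM !(inj_eq (@recolor_inj _ _ u)).
transitivity (\sum_k \sum_a A k a * T k a j); last first.
  rewrite /T; under eq_bigr do under eq_bigr do rewrite big_distrr/=.
  under eq_bigr do rewrite exchange_big/=.
  rewrite exchange_big/=; apply: eq_bigr => s _.
  under eq_bigr do under eq_bigr do rewrite big_distrr/=.
  under eq_bigr do rewrite exchange_big/=.
  rewrite exchange_big/=; apply: eq_bigr => t _.
  rewrite big_distrr mulr_suml/=; apply: eq_bigr => k _.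
  rewrite (bigD1 (recolor k t))//= eqxx big1 ?addr0 => [|a /negPf ak].
    by rewrite mulr1 mulrCA mulrA.
  by rewrite eq_sym ak mulr0 mul0r mulr0.
under eq_bigr do rewrite (HA _ (Tinv _)).
have Td a : \sum_k T k k a = (i == a)%:R.
  rewrite -Wg_numfix /T exchange_big/=; apply: eq_bigr => s _.
  rewrite exchange_big/=; apply: eq_bigr => t _; rewrite -mulr_suml -big_distrr/=.
  congr (_ * _ * _); rewrite /numfix -sum1dep_card natr_sum [RHS]big_mkcond.
  by apply: eq_bigr => k _; case: eqP.
rewrite exchange_big/=; under eq_bigr do rewrite -mulr_suml Td.
rewrite (bigD1 i)//= eqxx mul1r big1 ?addr0// => a /negPf.
by rewrite eq_sym => ->; rewrite mul0r.
Qed.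

End Projection.

(** * Polarization: invariant kernels from tensor powers *)

Section TensorPowers.
Variables (d : nat).

(* Ryser's formula, used as a polarization identity. *)
Lemma permanent_inclusion_exclusion (R : comNzRingType) (M : 'I_d -> 'I_d -> R) :
  \sum_(s : 'S_d) \prod_r M r (s r) =
  \sum_(S : {set 'I_d}) (\prod_q if q \in S then 1 else -1) *
     \prod_r \sum_(q in S) M r q.
Proof.
have E (S : {set 'I_d}) : \prod_r \sum_(q in S) M r q =
    \sum_(g : {ffun 'I_d -> 'I_d}) (\prod_r M r (g r)) * \prod_r (g r \in S)%:R.
  rewrite (eq_bigr (fun r => \sum_q M r q * (q \in S)%:R)) => [|r _].
    by rewrite bigA_distr_bigA /=; apply: eq_bigr => g _; rewrite big_split.
  by rewrite big_mkcond; apply: eq_bigr => q _; case: ifP; rewrite ?mulr1 ?mulr0.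
under [RHS]eq_bigr do rewrite E big_distrr/=.
rewrite exchange_big/=.
(* Inclusion-exclusion over the sets [S] containing the image of [g] leaves the surjective [g], that
   is, the permutations. *)
have onto (g : {ffun 'I_d -> 'I_d}) : \sum_(S : {set 'I_d})
    (\prod_q if q \in S then 1 else -1) * \prod_r (g r \in S)%:R =
    (injectiveb g)%:R :> R.
  transitivity (\prod_q (1 + - (q \notin codom g)%:R) : R).
    rewrite bigA_distr; apply: eq_big => // S _.
    apply: esym; rewrite [LHS](eq_bigr (fun q => (if q \in S then 1 else -1) *
       (if q \in S then 1 else (q \notin codom g)%:R))) => [|q _]; last first.
      by case: ifP; rewrite ?mulr1// mulN1r.
    rewrite big_split/=; congr (_ * _).
    have [/forallP gS|/forallPn [r rS]] := boolP [forall r, g r \in S].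
      rewrite [RHS]big1 => [|r _]; last by rewrite gS.
      rewrite big1// => q _; case: ifPn => // qS; rewrite (_ : _ \notin _) //.
      by apply: contra qS => /codomP [r ->].
    rewrite [RHS](bigD1 r)//= (negPf rS) mul0r (bigD1 (g r))//= (negPf rS).
    by rewrite codom_f mul0r.
  have [ginj|gninj] := boolP (injectiveb g).
    rewrite big1// => q _; rewrite (_ : q \notin _ = false) ?subr0//.
    by apply/negbTE; rewrite negbK; apply: inj_card_onto => //; apply/injectiveP.
  have : ~~ [forall q, q \in codom g].
    apply: contra gninj => /forallP onto.
    change (is_true (uniq (codom g))); apply/card_uniqP; rewrite size_codom.
    by apply: eq_card => q; rewrite onto.
  move=> /forallPn [q qg].
  by rewrite (bigD1 q)//= qg subrr mul0r.
rewrite [RHS](eq_bigr (fun g : {ffun 'I_d -> 'I_d} =>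
  if injectiveb g then \prod_r M r (g r) else 0)); last first.
  move=> g _; under eq_bigr do rewrite mulrCA.
  by rewrite -big_distrr/= onto; case: ifP; rewrite ?mulr1 ?mulr0.
rewrite -[RHS]big_mkcond (reindex_omap (val : 'S_d -> _) insub) => [|g gi]; last first.
  by rewrite insubT.
apply: eq_big => [s|s _]; first by rewrite (valP s) valK eqxx.
by apply: eq_bigr => r _; rewrite -pvalE.
Qed.

Section Commutant.
Variables (F : numFieldType) (N : nat).
Local Notation index := {ffun 'I_d -> 'I_N}.

Definition tensorpow (X : 'M[F]_N) (i j : index) : F := \prod_r X (i r) (j r).

Lemma kcomm_sum (J : finType) (A : index -> index -> F) (c : J -> F)
    (B : J -> index -> index -> F) :
  (forall x, kcomm A (B x)) -> kcomm A (fun i j => \sum_x c x * B x i j).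
Proof.
move=> AB i j; under eq_bigr do rewrite big_distrr/=.
under [RHS]eq_bigr do rewrite mulr_suml.
rewrite exchange_big [RHS]exchange_big/=; apply: eq_bigr => x _.
under eq_bigr do rewrite mulrCA; under [RHS]eq_bigr do rewrite -mulrA.
by rewrite -!big_distrr/= AB.
Qed.

Lemma kcomm_ext (A B B' : index -> index -> F) :
  (forall i j, B i j = B' i j) -> kcomm A B -> kcomm A B'.
Proof.
move=> BB AB i j; under eq_bigr do rewrite -BB.
by rewrite AB; apply: eq_bigr => k _; rewrite BB.
Qed.

(** An invariant kernel is a combination of symmetrized tensor products of elementary matrices. By
    polarization these are combinations of tensor powers. *)
Lemma kcomm_invariant (A : index -> index -> F) :
  (forall X, kcomm A (tensorpow X)) -> forall T, kinvariant T -> kcomm A T.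
Proof.
move=> HA T HT.
(* The sum over [q] in [S] of the elementary matrices at row [a q] and column [b q]. *)
pose X (a b : index) (S : {set 'I_d}) : 'M[F]_N :=
  \matrix_(x, y) \sum_(q in S) (a q == x)%:R * (b q == y)%:R.
have d0 : d`!%:R != 0 :> F by rewrite pnatr_eq0 -lt0n fact_gt0.
pose c S : F := \prod_(q : 'I_d) if q \in (S : {set 'I_d}) then 1 else -1.
suff E i j : T i j = \sum_(u : index * index)
    (d`!%:R^-1 * T u.1 u.2) * \sum_S c S * tensorpow (X u.1 u.2 S) i j.
  apply: (kcomm_ext (fun i j => esym (E i j))); apply: kcomm_sum => u.
  by apply: kcomm_sum.
have E u : \sum_S c S * tensorpow (X u.1 u.2 S) i j =
    \sum_(s : 'S_d) \prod_r ((u.1 (s r) == i r)%:R * (u.2 (s r) == j r)%:R).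
  rewrite (permanent_inclusion_exclusion
    (fun r q => (u.1 q == i r)%:R * (u.2 q == j r)%:R)).
  by apply: eq_bigr => S _; congr (_ * _); apply: eq_bigr => r _; rewrite mxE.
under eq_bigr do rewrite E -mulrA.
rewrite -big_distrr/=; apply: (canRL (mulKf d0)).
under eq_bigr do rewrite big_distrr/=; rewrite exchange_big/=.
transitivity (\sum_(s : 'S_d) T i j).
  by rewrite sumr_const card_Sn mulr_natl.
apply: eq_bigr => s _.
(* The only pair with nonzero weight is [(i, j)] recoloured by [s^-1], where invariance gives the
   value [T i j]. *)
rewrite (bigD1 (recolor i s^-1, recolor j s^-1)%g)//= [X in _ + X]big1 => [|[a b] /= ab].
  rewrite addr0 HT big1 ?mulr1// => r _.
  by rewrite !ffunE !permK !eqxx mulr1.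
suff : ~~ [forall r, (a (s r) == i r) && (b (s r) == j r)].
  move=> /forallPn [r abr]; rewrite (bigD1 r)//= -natrM mulnb (negPf abr).
  by rewrite mul0r mulr0.
apply: contra ab => /forallP ab; rewrite xpair_eqE; apply/andP; split;
  apply/eqP/ffunP => r; rewrite ffunE; apply/eqP.
  by case/andP: (ab (s^-1 r)%g); rewrite permKV.
by case/andP: (ab (s^-1 r)%g); rewrite permKV.
Qed.

End Commutant.
End TensorPowers.

(** * From unitary matrices to all matrices *)

Section UnitaryInvariance.
Variables (C : numClosedFieldType) (N d : nat).
Local Notation index := {ffun 'I_d -> 'I_N}.
Implicit Types (A : index -> index -> C) (X Y V : 'M[C]_N).
Local Open Scope sesquilinear_scope.

Lemma tensorpowM X Y (i j : index) :
  \sum_k tensorpow X i k * tensorpow Y k j = tensorpow (X *m Y) i j.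
Proof.
rewrite /tensorpow; under [RHS]eq_bigr do rewrite mxE.
rewrite bigA_distr_bigA /=; apply: eq_bigr => k _.
by rewrite -big_split.
Qed.

Lemma kcomm_tensorM A X Y :
  kcomm A (tensorpow X) -> kcomm A (tensorpow Y) -> kcomm A (tensorpow (X *m Y)).
Proof.
move=> HX HY i j.
transitivity (\sum_k (\sum_l A i l * tensorpow X l k) * tensorpow Y k j).
  under eq_bigr do rewrite -tensorpowM big_distrr/=.
  under [RHS]eq_bigr do rewrite mulr_suml; rewrite exchange_big/=.
  by apply: eq_bigr => k _; apply: eq_bigr => l _; rewrite mulrA.
under eq_bigr do rewrite HX mulr_suml; rewrite exchange_big/=.
under [RHS]eq_bigr do rewrite -tensorpowM mulr_suml; rewrite [RHS]exchange_big/=.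
apply: eq_bigr => l _; under eq_bigr do rewrite -mulrA.
rewrite -big_distrr/= HY big_distrr/=; apply: eq_bigr => k _.
by rewrite mulrA.
Qed.

Definition dmx (z : 'I_N -> C) : 'M[C]_N := diag_mx (\row_a z a).

Lemma tensorpow_diag (z : 'I_N -> C) (i j : index) :
  tensorpow (dmx z) i j = (\prod_r z (j r)) * (i == j)%:R.
Proof.
rewrite /tensorpow /dmx; case: eqP => [->|ij].
  by rewrite mulr1; apply: eq_bigr => r _; rewrite !mxE eqxx mulr1n.
rewrite mulr0; have [r ijr] : exists r, i r != j r.
  apply/existsP; rewrite -negb_forall; apply/negP => /forallP e; apply: ij.
  by apply/ffunP => r; apply/eqP.
by rewrite (bigD1 r)//= !mxE (negPf ijr) mulr0n mul0r.
Qed.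

Lemma kcomm_diagE A z : kcomm A (tensorpow (dmx z)) <->
  forall i j, A i j * \prod_r z (j r) = A i j * \prod_r z (i r).
Proof.
have E1 i j : \sum_k A i k * tensorpow (dmx z) k j = A i j * \prod_r z (j r).
  rewrite (bigD1 j)//= big1 ?addr0 => [|k /negPf kj]; rewrite tensorpow_diag.
    by rewrite eqxx mulr1.
  by rewrite kj !mulr0.
have E2 i j : \sum_k tensorpow (dmx z) i k * A k j = A i j * \prod_r z (i r).
  rewrite (bigD1 i)//= big1 ?addr0 => [|k /negPf ik]; rewrite tensorpow_diag.
    by rewrite eqxx mulr1 mulrC.
  by rewrite eq_sym ik mulr0 mul0r.
by split=> H i j; have := H i j; rewrite E1 E2.
Qed.

(** For [a < b], a root of order [b - a] of [-1] satisfies [w ^ b = - w ^ a]. *)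
Lemma unimodular_exp_neq (a b : nat) : a != b ->
  exists2 w : C, `|w| = 1 & w ^+ a != w ^+ b.
Proof.
wlog ab : a b / (a < b)%N => [hw|_].
  rewrite neq_ltn => /orP[] ab; first by apply: hw => //; rewrite ltn_eqF.
  by have [|w w1 wab] := hw b a ab; [rewrite ltn_eqF|exists w => //; rewrite eq_sym].
have m0 : (0 < b - a)%N by rewrite subn_gt0.
pose w : C := (b - a).-root (-1).
have wm : w ^+ (b - a) = -1 by rewrite rootCK.
have w1 : `|w| = 1.
  apply/eqP; rewrite -(@pexpr_eq1 _ _ (b - a))//.
  by rewrite -normrX wm normrN1.
exists w => //; rewrite -(subnKC (ltnW ab)) exprD wm mulrN1 -addr_eq0 -mulr2n.
have : w ^+ a != 0 by rewrite expf_neq0// -normr_gt0 w1.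
by rewrite mulrn_eq0.
Qed.

(** Unimodular diagonal matrices already separate colour counts, so a nonzero [A i j] forces [i] and
    [j] to have equal counts. Every diagonal tensor power then has the same eigenvalue at both. *)
Lemma kcomm_diag A :
  (forall z, (forall a, `|z a| = 1) -> kcomm A (tensorpow (dmx z))) ->
  forall z, kcomm A (tensorpow (dmx z)).
Proof.
move=> HA z; apply/kcomm_diagE => i j.
have [->|Aij] := eqVneq (A i j) 0; first by rewrite !mul0r.
congr (_ * _); rewrite !prod_colcount; apply: eq_bigr => t _; congr (_ ^+ _).
apply/eqP; apply: contraT => /unimodular_exp_neq [w wn w1].
(* Its tensor power has eigenvalues [w ^ colcount i t] and [w ^ colcount j t] at the two
   multi-indices. *)
pose zt a := if a == t then w else 1.
have /kcomm_diagE/(_ i j) : kcomm A (tensorpow (dmx zt)).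
  by apply: HA => a; rewrite /zt; case: ifP; rewrite ?wn ?normr1.
have ztE (f : index) : \prod_r zt (f r) = w ^+ colcount f t.
  rewrite prod_colcount (bigD1 t)//= /zt eqxx big1 ?mulr1// => a /negPf ->.
  by rewrite expr1n.
by move=> /(mulfI Aij); rewrite !ztE => e; rewrite e eqxx in w1.
Qed.

(** By the spectral theorem, a normal matrix is a unitary conjugate of a diagonal one. *)
Lemma kcomm_normal A :
  (forall V, V \is unitarymx -> kcomm A (tensorpow V)) ->
  forall X, X \is normalmx -> kcomm A (tensorpow X).
Proof.
move=> HA X /orthomx_spectralP ->.
have Pu := spectral_unitarymx X.
have D z : kcomm A (tensorpow (dmx z)).
  apply: kcomm_diag => {}z z1; apply: HA; apply/unitarymxP.
  apply/matrixP => a b; rewrite /dmx mul_diag_mx !mxE.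
  case: eqVneq => [->|ab]; first by rewrite ?eqxx !mulr1n -normCK z1 expr1n.
  by rewrite !mulr0n ?rmorph0 mulr0.
apply: kcomm_tensorM; last exact: HA.
apply: kcomm_tensorM; first by rewrite (invmx_unitary Pu); apply: HA; rewrite trmxC_unitary.
have := D (fun a => spectral_diag X 0 a); rewrite /dmx.
by congr (kcomm _ (tensorpow (diag_mx _))); apply/rowP => a; rewrite mxE.
Qed.

Lemma poly_natr_eq0 (p : {poly C}) : (forall n : nat, p.[n%:R] = 0) -> p = 0.
Proof.
move=> H; apply/eqP; apply: contraT => p0.
have := max_poly_roots p0 (rs := [seq n%:R | n <- iota 0 (size p)]).
rewrite size_map size_iota ltnn; apply.
  by apply/allP => _ /mapP[n _ ->]; apply/rootP.
rewrite map_inj_uniq ?iota_uniq// => m n /eqP.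
by rewrite eqr_nat => /eqP.
Qed.

(* Polynomiality in [z] of the commutation with [H1 + z H2], for the Hermitian
   parts [H1], [H2] of [X], extends it from integers to [z = i]. *)
Lemma kcomm_unitary A :
  (forall V, V \is unitarymx -> kcomm A (tensorpow V)) ->
  forall X, kcomm A (tensorpow X).
Proof.
move=> HA X i j.
pose H1 : 'M[C]_N := 2^-1 *: (X + X ^t*).
pose H2 : 'M[C]_N := (2 * 'i%R)^-1 *: (X - X ^t*).
pose P (a b : index) : {poly C} := \prod_r ((H1 (a r) (b r))%:P + H2 (a r) (b r) *: 'X).
have PE z a b : (P a b).[z] = tensorpow (H1 + z *: H2) a b.
  rewrite horner_prod; apply: eq_bigr => r _.
  by rewrite !hornerE [in RHS]mxE [in X in _ = _ + X]mxE mulrC.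
have n0 : 2 != 0 :> C by rewrite pnatr_eq0.
have i0 : 'i%R != 0 :> C := neq0Ci C.
have XE : X = H1 + 'i%R *: H2.
  by apply/matrixP => a b; rewrite !mxE; field.
have herm (n : nat) : H1 + n%:R *: H2 \is normalmx.
  apply/normalmxP; suff -> : (H1 + n%:R *: H2)^t* = H1 + n%:R *: H2 by [].
  apply/matrixP => a b; rewrite !mxE.
  rewrite !(rmorphD, rmorphM, rmorphN, fmorphV, rmorph_nat, conjCK, conjCi)/=.
  by rewrite rmorph1 conjCi conjCK; field; rewrite ?oppr_eq0 ?i0 ?n0.
pose p := \sum_k (A i k)%:P * P k j - \sum_k P i k * (A k j)%:P.
have pE z : p.[z] = \sum_k A i k * tensorpow (H1 + z *: H2) k j -
    \sum_k tensorpow (H1 + z *: H2) i k * A k j.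
  rewrite /p hornerD hornerN !horner_sum; congr (_ - _); apply: eq_bigr => k _.
    by rewrite hornerM hornerC PE.
  by rewrite hornerM hornerC PE.
have p0 : p = 0.
  apply: poly_natr_eq0 => n; rewrite pE; apply/eqP; rewrite subr_eq0; apply/eqP.
  exact: (kcomm_normal HA).
by apply/eqP; rewrite -subr_eq0 [X in tensorpow X]XE -pE p0 horner0.
Qed.

End UnitaryInvariance.

(** * Haar expectations *)

Section ComplexMeasurable.
Context (R : realType) (d : measure_display) (T : measurableType d).
Implicit Types f g : T -> R[i].
Local Open Scope classical_set_scope.

Definition cmeasurable f : Prop :=
  measurable_fun [set: T] (fun x => complex.Re (f x)) /\
  measurable_fun [set: T] (fun x => complex.Im (f x)).

Lemma cmeasurable_cst c : cmeasurable (fun=> c).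
Proof. by split; exact: measurable_cst. Qed.

Lemma cmeasurableD f g : cmeasurable f -> cmeasurable g ->
  cmeasurable (fun x => f x + g x).
Proof.
move=> [f1 f2] [g1 g2]; split.
  rewrite (_ : (fun x => _) = (fun x => complex.Re (f x)) \+ (fun x => complex.Re (g x))).
    exact: measurable_funD.
  by apply/funext => x /=; case: (f x) (g x) => ? ? [? ?].
rewrite (_ : (fun x => _) = (fun x => complex.Im (f x)) \+ (fun x => complex.Im (g x))).
  exact: measurable_funD.
by apply/funext => x /=; case: (f x) (g x) => ? ? [? ?].
Qed.

Lemma cmeasurableM f g : cmeasurable f -> cmeasurable g ->
  cmeasurable (fun x => f x * g x).
Proof.
move=> [f1 f2] [g1 g2]; split.
  rewrite (_ : (fun x => _) = (fun x => complex.Re (f x)) \* (fun x => complex.Re (g x)) \-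
      (fun x => complex.Im (f x)) \* (fun x => complex.Im (g x))).
    by apply: measurable_funB; exact: measurable_funM.
  by apply/funext => x /=; case: (f x) (g x) => ? ? [? ?].
rewrite (_ : (fun x => _) = (fun x => complex.Re (f x)) \* (fun x => complex.Im (g x)) \+
    (fun x => complex.Im (f x)) \* (fun x => complex.Re (g x))).
  by apply: measurable_funD; exact: measurable_funM.
by apply/funext => x /=; case: (f x) (g x) => ? ? [? ?].
Qed.

Lemma cmeasurable_conj f : cmeasurable f -> cmeasurable (fun x => conjc (f x)).
Proof.
move=> [f1 f2]; split.
  by rewrite (_ : (fun x => _) = (fun x => complex.Re (f x)))//; apply/funext => x; case: (f x).
rewrite (_ : (fun x => _) = \- (fun x => complex.Im (f x))).
  exact: measurable_funN.
by apply/funext => x /=; case: (f x).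
Qed.

End ComplexMeasurable.

(** * Expectations of functions of a Haar matrix *)

Section HaarExpectation.
Context (R : realType) (d : measure_display) (Omega : measurableType d).
Variables (P : probability Omega R) (N : nat) (U : Omega -> 'M[R[i]]_N).
Hypothesis hU : haar_distributed P U.
Implicit Types g h : 'M[R[i]]_N -> R[i].
Local Open Scope classical_set_scope.

(** Left inverse of [mxcoords], which turns functions of a matrix into functions on the measurable
    space of coordinates. *)
Definition decode (t : (N * N).-tuple (R * R)%type) : 'M[R[i]]_N :=
  \matrix_(a, b) ((tnth t (mxvec_index a b)).1 +i* (tnth t (mxvec_index a b)).2).

Lemma mxcoordsK : cancel (@mxcoords R N) decode.
Proof.
move=> M; apply/matrixP => a b; rewrite mxE tnth_mktuple /= mxvecE.
by case: (M a b).
Qed.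

(* Functions of a matrix whose composition with [U] is integrable. *)
Definition regular g : Prop :=
  cmeasurable (fun t => g (decode t)) /\
  exists B : R, forall M, unitary M ->
    `|complex.Re (g M)| <= B /\ `|complex.Im (g M)| <= B.

Lemma regular_cst c : regular (fun=> c).
Proof.
split; first exact: cmeasurable_cst.
exists (`|complex.Re c| + `|complex.Im c|) => M _.
by split; rewrite ?lerDl ?lerDr normr_ge0.
Qed.

Lemma regularD g h : regular g -> regular h -> regular (fun M => g M + h M).
Proof.
move=> [mg [B HB]] [mh [B' HB']]; split; first exact: cmeasurableD.
exists (B + B') => M /[dup] /HB + /HB'; case: (g M) (h M) => a b [a' b'] /=.
by move=> [? ?] [? ?]; split; rewrite (le_trans (ler_normD _ _))// lerD.
Qed.

Lemma regularM g h : regular g -> regular h -> regular (fun M => g M * h M).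
Proof.
move=> [mg [B HB]] [mh [B' HB']]; split; first exact: cmeasurableM.
exists (B * B' + B * B') => M /[dup] /HB + /HB'; case: (g M) (h M) => a b [a' b'] /=.
move=> [? ?] [? ?]; split.
  by rewrite (le_trans (ler_normB _ _))// !normrM lerD// ler_pM.
by rewrite (le_trans (ler_normD _ _))// !normrM lerD// ler_pM.
Qed.

Lemma regular_conj g : regular g -> regular (fun M => conjc (g M)).
Proof.
move=> [mg [B HB]]; split; first exact: cmeasurable_conj.
by exists B => M /HB; case: (g M) => a b /=; rewrite normrN.
Qed.

Lemma regular_sum (I : Type) (r : seq I) (Q : pred I) (g : I -> 'M[R[i]]_N -> R[i]) :
  (forall x, regular (g x)) -> regular (fun M => \sum_(x <- r | Q x) g x M).
Proof.
move=> Hg; elim: r => [|x r IH].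
  by under eq_fun do rewrite big_nil; exact: regular_cst.
under eq_fun do rewrite big_cons.
by case: (Q x) => //; exact: regularD.
Qed.

Lemma regular_prod (I : Type) (r : seq I) (Q : pred I) (g : I -> 'M[R[i]]_N -> R[i]) :
  (forall x, regular (g x)) -> regular (fun M => \prod_(x <- r | Q x) g x M).
Proof.
move=> Hg; elim: r => [|x r IH].
  by under eq_fun do rewrite big_nil; exact: regular_cst.
under eq_fun do rewrite big_cons.
by case: (Q x) => //; exact: regularM.
Qed.

Lemma unitary_row (M : 'M[R[i]]_N) a : unitary M ->
  \sum_b (complex.Re (M a b) ^+ 2 + complex.Im (M a b) ^+ 2) = 1.
Proof.
move=> /matrixP/(_ a a)/(congr1 (@complex.Re R)).
rewrite !mxE eqxx raddf_sum /= => <-; apply: eq_bigr => b _.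
by rewrite !mxE; case: (M a b) => x y /=; rewrite mulrN opprK -!expr2.
Qed.

(** Boundedness holds because the rows of a unitary matrix have norm one. *)
Lemma regular_entry a b : regular (fun M => M a b).
Proof.
split.
  have m1 := @measurable_tnth _ (R * R)%type (N * N) (mxvec_index a b).
  split; under eq_fun do rewrite mxE /=.
    exact: (measurableT_comp measurable_fst m1).
  exact: (measurableT_comp measurable_snd m1).
exists 1 => M /(unitary_row a); rewrite (bigD1 b)//=.
set S := \sum_(c | _) _ => e.
have S0 : 0 <= S by apply: sumr_ge0 => c _; rewrite addr_ge0// sqr_ge0.
have [x0 y0] := (sqr_ge0 (complex.Re (M a b)), sqr_ge0 (complex.Im (M a b))).
by split; rewrite -(@expr_le1 _ 2)// real_normK ?num_real// -e; lra.
Qed.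

Lemma regular_integrable g : regular g ->
  P.-integrable [set: Omega] (EFin \o (fun w => complex.Re (g (U w)))) /\
  P.-integrable [set: Omega] (EFin \o (fun w => complex.Im (g (U w)))).
Proof.
case: hU => Uu mU _ [[m1 m2] [B HB]].
have fin : (P [set: Omega] < +oo)%E by rewrite probability_setT ltry.
split; apply: measurable_bounded_integrable => //.
- under eq_fun do rewrite -[U _]mxcoordsK.
  exact: (measurableT_comp m1 mU).
- exists B; split; first exact: num_real.
  by move=> x Bx w _ /=; have [+ _] := HB _ (Uu w); move=> /le_trans; apply; exact: ltW.
- under eq_fun do rewrite -[U _]mxcoordsK.
  exact: (measurableT_comp m2 mU).
- exists B; split; first exact: num_real.
  by move=> x Bx w _ /=; have [_ +] := HB _ (Uu w); move=> /le_trans; apply; exact: ltW.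
Qed.

Lemma cexpectD g h : regular g -> regular h ->
  cexpect P (fun w => g (U w) + h (U w)) =
  cexpect P (fun w => g (U w)) + cexpect P (fun w => h (U w)).
Proof.
move=> /regular_integrable[g1 g2] /regular_integrable[h1 h2]; rewrite /cexpect.
rewrite (_ : (fun w => complex.Re _) =
    (fun w => complex.Re (g (U w)) + complex.Re (h (U w)))); last first.
  by apply/funext => w; case: (g _) (h _) => ? ? [? ?].
rewrite (_ : (fun w => complex.Im (_ + _)) =
    (fun w => complex.Im (g (U w)) + complex.Im (h (U w)))); last first.
  by apply/funext => w; case: (g _) (h _) => ? ? [? ?].
by rewrite !RintegralD// !rmorphD/= mulrDr addrACA.
Qed.

Lemma cexpectZ c g : regular g ->
  cexpect P (fun w => c * g (U w)) = c * cexpect P (fun w => g (U w)).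
Proof.
move=> /regular_integrable[g1 g2]; rewrite /cexpect; case: c => x y.
rewrite (_ : (fun w => complex.Re _) =
    (fun w => x * complex.Re (g (U w)) + (- y) * complex.Im (g (U w)))); last first.
  by apply/funext => w; case: (g _) => ? ? /=; rewrite mulNr.
rewrite (_ : (fun w => complex.Im (_ * _)) =
    (fun w => x * complex.Im (g (U w)) + y * complex.Re (g (U w)))); last first.
  by apply/funext => w; case: (g _) => ? ? /=.
have iZ (f : Omega -> R) (r : R) : P.-integrable [set: Omega] (EFin \o f) ->
    P.-integrable [set: Omega] (EFin \o (fun w => r * f w)).
  by move=> fi; have := integrableZl measurableT r fi; apply: eq_integrable.
rewrite !RintegralD//; [|exact: iZ..].
rewrite !RintegralZl//.
by apply/eqP; rewrite eq_complex /=; apply/andP; split; apply/eqP => /=; ring.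
Qed.

Lemma cexpect_cst c : cexpect P (fun=> c) = c.
Proof.
have p1 : fine (P [set: Omega]) = 1 by rewrite probability_setT.
rewrite /cexpect !Rintegral_cst//.
transitivity ((complex.Re c * 1)%:C + 'i * (complex.Im c * 1)%:C).
  by congr ((_ * _)%:C + 'i * (_ * _)%:C).
rewrite !mulr1.
by case: c => x y; apply/eqP; rewrite eq_complex /=; apply/andP; split; apply/eqP => /=; ring.
Qed.

Lemma cexpect_sum (I : finType) (c : I -> R[i]) (g : I -> 'M[R[i]]_N -> R[i]) :
  (forall x, regular (g x)) ->
  cexpect P (fun w => \sum_x c x * g x (U w)) =
  \sum_x c x * cexpect P (fun w => g x (U w)).
Proof.
move=> Hg; elim: (index_enum I) => [|x r IH].
  by under eq_fun do rewrite big_nil; rewrite big_nil cexpect_cst.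
under eq_fun do rewrite big_cons.
have rZ z : regular (fun M => c z * g z M) by apply: regularM => //; exact: regular_cst.
rewrite big_cons -IH -cexpectZ//.
by rewrite -(cexpectD (rZ x) (regular_sum r predT rZ)).
Qed.

Lemma regular_mulmx V g : unitary V -> regular g -> regular (fun M => g (V *m M)) /\
  measurable_fun [set: Omega] (fun w => mxcoords (V *m U w)).
Proof.
move=> Vu [mg [B HB]]; case: hU => _ mU _.
have rVM a b : regular (fun M => (V *m M) a b).
  under eq_fun do rewrite mxE; apply: regular_sum => c.
  by apply: regularM; [exact: regular_cst|exact: regular_entry].
have menc : measurable_fun setT (fun t => mxcoords (V *m decode t)).
  apply/measurable_fun_tnthP => q; case/mxvec_indexP: q => a b.
  rewrite (_ : _ \o _ = fun t => (complex.Re ((V *m decode t) a b), complex.Im ((V *m decode t) a b))).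
    by have [[? ?] _] := rVM a b; exact: measurable_fun_pair.
  by apply/funext => t /=; rewrite tnth_mktuple mxvecE.
split; last first.
  under eq_fun do rewrite -[U _]mxcoordsK.
  exact: (measurableT_comp menc mU).
have VV M : unitary M -> unitary (V *m M).
  move=> HM; rewrite /unitary /adj map_mxM trmx_mul mulmxA -(mulmxA V).
  by rewrite HM mulmx1.
split; last by exists B => M /VV /HB.
case: mg => m1 m2; split; under eq_fun do rewrite -[V *m _]mxcoordsK.
  exact: (measurableT_comp m1 menc).
exact: (measurableT_comp m2 menc).
Qed.

(** The coordinates of [U] and of [V *m U] have the same law, and both integrals are transported to
    the space of coordinates through [decode]. *)
Lemma cexpect_invariant V g : unitary V -> regular g ->
  cexpect P (fun w => g (V *m U w)) = cexpect P (fun w => g (U w)).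
Proof.
move=> Vu rg; have [rVg mVU] := regular_mulmx Vu rg.
have [i1 i2] := regular_integrable rg; have [i1' i2'] := regular_integrable rVg.
case: rg => [[m1 m2] _]; case: hU => _ mU inv.
suff H (f : 'M[R[i]]_N -> R) : measurable_fun setT (fun t => f (decode t)) ->
    P.-integrable [set: Omega] (EFin \o (fun w => f (U w))) ->
    P.-integrable [set: Omega] (EFin \o (fun w => f (V *m U w))) ->
    Rintegral P setT (fun w => f (V *m U w)) = Rintegral P setT (fun w => f (U w)).
  by rewrite /cexpect (H (fun M => complex.Re (g M)))// (H (fun M => complex.Im (g M))).
move=> mf if1 if2; congr fine.
have mE : measurable_fun setT (EFin \o (fun t => f (decode t))) by exact/measurable_EFinP.
have E (X : Omega -> 'M[R[i]]_N) : EFin \o (fun w => f (X w)) =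
    (EFin \o (fun t => f (decode t))) \o (fun w => mxcoords (X w)).
  by apply/funext => w /=; rewrite mxcoordsK.
rewrite E in if1; rewrite (E (fun w => V *m U w)) in if2.
have := integral_pushforward mVU mE if2 measurableT.
have := integral_pushforward mU mE if1 measurableT.
rewrite !preimage_setT -!E /= => <- <-; apply: eq_measure_integral => A mA _.
exact: inv.
Qed.

End HaarExpectation.

(** * Traces over cycles as power sums *)

Section CyclePowerSum.
Variables (d : nat) (C : comNzRingType) (N : nat) (lam : 'I_N -> C).
Implicit Type t : 'S_d.

(** A colouring fixed by [t] is a colouring of its cycles, so distributing the product over the
    cycles gives the sum over such colourings. *)
Lemma Trperm_powersum t : Trperm t lam = powersum lam t.
Proof.
pose cyc := {c : {set 'I_d} | c \in porbits t}.
pose cy x : cyc := Sub (porbit t x) (imset_f _ isT).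
have cycP (c : cyc) : exists x, val c == porbit t x.
  by have /imsetP [x _ e] := valP c; exists x; apply/eqP.
pose rep (c : cyc) := xchoose (cycP c).
have repK c : cy (rep c) = c.
  by apply/val_inj; rewrite /= -(eqP (xchooseP (cycP c))).
have cyt x : cy (t x) = cy x.
  apply/val_inj => /=; apply/eqP; rewrite eq_porbit_mem.
  by have := mem_porbit t 1 x; rewrite expg1.
rewrite /Trperm (big_sub _ (fun c : {set 'I_d} => \sum_r lam r ^+ #|c|)) bigA_distr_bigA /=.
rewrite /powersum (reindex_onto (fun h : {ffun cyc -> 'I_N} => [ffun x => h (cy x)])
   (fun f => [ffun c => f (rep c)])) /=; last first.
  move=> f /eqP ft; apply/ffunP => x; rewrite !ffunE.
  have : rep (cy x) \in porbit t x.
    by rewrite -eq_porbit_mem; apply/eqP; have /(congr1 val) := repK (cy x).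
  move=> /porbitP [m ->]; elim: m => [|m IH]; first by rewrite expg0 perm1.
  by rewrite expgSr permM -{1}ft [LHS]ffunE in IH *.
apply: eq_big => [h|h _].
  apply/esym/andP; split; apply/eqP/ffunP => x; rewrite !ffunE ?cyt//.
  by rewrite repK.
rewrite [RHS](partition_big cy predT)//=; apply: eq_bigr => c _.
rewrite (eq_bigr (fun=> lam (h c))) => [|x /eqP <-]; last by rewrite ffunE.
rewrite -prodr_const; apply: eq_bigl => x; rewrite -val_eqE /=.
by have /eqP -> := xchooseP (cycP c); rewrite eq_porbit_mem porbit_sym.
Qed.

End CyclePowerSum.

(** * Moments of the random matrix *)

Section HaarMoments.
Context (R : realType) (d0 : measure_display) (Omega : measurableType d0).
Variables (P : probability Omega R) (N : nat) (U : Omega -> 'M[R[i]]_N).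
Hypothesis hU : haar_distributed P U.
Variables (lam : 'I_N -> R) (d : nat).
Local Notation index := {ffun 'I_d -> 'I_N}.

Let D : 'M[R[i]]_N := diag_mx (\row_r (lam r)%:C).

Definition conj_diag (M : 'M[R[i]]_N) : 'M[R[i]]_N := M *m D *m adj M.

Lemma conj_diagE M a b :
  conj_diag M a b = \sum_m M a m * (lam m)%:C * conjc (M b m).
Proof.
rewrite mxE; apply: eq_bigr => m _.
by rewrite mul_mx_diag !mxE.
Qed.

Lemma regular_conj_diag (i j : index) : regular (fun M => tensorpow (conj_diag M) i j).
Proof.
apply: regular_prod => r; under eq_fun do rewrite conj_diagE.
apply: regular_sum => m; apply: regularM.
  by apply: regularM; [exact: regular_entry|exact: regular_cst].
by apply: regular_conj; exact: regular_entry.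
Qed.

Lemma unitaryC (M : 'M[R[i]]_N) : unitary M -> adj M *m M = 1%:M.
Proof. exact: mulmx1C. Qed.

Lemma unitarymxE (M : 'M[R[i]]_N) : M \is unitarymx -> unitary M.
Proof.
move=> /unitarymxP; rewrite /unitary /adj => <-.
by congr (_ *m _); apply/matrixP => a b; rewrite !mxE.
Qed.

Definition moment (i j : index) : R[i] :=
  cexpect P (fun w => tensorpow (conj_diag (U w)) i j).

(** Left invariance makes the moment equal to its conjugate by the tensor power of [V]; multiplying
    by that power on the right gives commutation. *)
Lemma moment_kcomm (V : 'M[R[i]]_N) : V \is unitarymx -> kcomm moment (tensorpow V).
Proof.
move=> /unitarymxE Vu.
have E i j : moment i j = \sum_(u : index * index)
    (tensorpow V i u.1 * tensorpow (adj V) u.2 j) * moment u.1 u.2.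
  rewrite /moment -(cexpect_invariant hU Vu (regular_conj_diag i j)).
  rewrite -(cexpect_sum hU _ (fun u : index * index => regular_conj_diag u.1 u.2)).
  congr (cexpect P _); apply/funext => w.
  have -> : conj_diag (V *m U w) = V *m (conj_diag (U w) *m adj V).
    by rewrite /conj_diag /adj map_mxM trmx_mul !mulmxA.
  rewrite -tensorpowM; under eq_bigr do rewrite -tensorpowM big_distrr/=.
  rewrite pair_bigA /=; apply: eq_bigr => u _.
  by rewrite mulrA mulrAC.
have tp1 (i j : index) : tensorpow 1%:M i j = (i == j)%:R :> R[i].
  have -> : 1%:M = dmx (fun _ : 'I_N => 1) :> 'M[R[i]]_N.
    by apply/matrixP => a b; rewrite /dmx !mxE.
  by rewrite tensorpow_diag big1 ?mul1r.
move=> i j; under eq_bigr do rewrite E mulr_suml.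
rewrite exchange_big/=.
transitivity (\sum_(u : index * index) tensorpow V i u.1 * moment u.1 u.2 * (u.2 == j)%:R).
  apply: eq_bigr => u _; rewrite -tp1 -(unitaryC Vu) -tensorpowM big_distrr/=.
  by apply: eq_bigr => k _; ring.
rewrite -(pair_bigA _ (fun a b => tensorpow V i a * moment a b * (b == j)%:R))/=.
apply: eq_bigr => k _; rewrite (bigD1 j)//= eqxx mulr1 big1 ?addr0// => a /negPf ->.
by rewrite mulr0.
Qed.

(** Once [k] is summed, orthonormality of the columns of [M] leaves only the colourings [m] by
    eigenvalue indices that are fixed by [t]. *)
Lemma trace_conj_diag (t : 'S_d) (M : 'M[R[i]]_N) : unitary M ->
  \sum_(k : index) tensorpow (conj_diag M) k (recolor k t) = Trperm t (fun r => (lam r)%:C).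
Proof.
move=> /unitaryC Mu.
have MM x y : \sum_a M a y * conjc (M a x) = (x == y)%:R.
  have := congr1 (fun A : 'M[R[i]]_N => A x y) Mu; rewrite !mxE => <-.
  by apply: eq_bigr => a _; rewrite !mxE mulrC.
rewrite Trperm_powersum /tensorpow.
transitivity (\sum_(k : index) \sum_(m : index) (\prod_r (lam (m r))%:C) *
    \prod_r (M (k r) (m r) * conjc (M (k r) (m (t^-1%g r))))).
  apply: eq_bigr => k _; under eq_bigr do rewrite conj_diagE.
  rewrite bigA_distr_bigA /=; apply: eq_bigr => m _.
  (* The conjugate factors are reindexed by [t], so that both factors with row [k r] stand
     together. *)
  have e : \prod_r conjc (M (k r) (m (t^-1%g r))) =
      \prod_r conjc (M (recolor k t r) (m r)).
    rewrite (reindex_inj (@perm_inj _ t)) /=; apply: eq_bigr => r _.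
    by rewrite ffunE permK.
  by rewrite !big_split/= e mulrA [X in X * _]mulrC.
rewrite exchange_big [RHS]big_mkcond /=; apply: eq_bigr => m _.
rewrite -big_distrr/= -(bigA_distr_bigA (fun r a => M a (m r) * conjc (M a (m (t^-1%g r))))) /=.
under [X in _ * X]eq_bigr do rewrite MM.
case: ifPn => [/eqP mt|].
  rewrite [X in _ * X]big1 ?mulr1// => r _.
  by rewrite -{1}mt ffunE permKV eqxx.
rewrite recolorE => /forallPn [r mr].
by rewrite [X in _ * X](bigD1 (t r))//= permK eq_sym (negPf mr) mul0r mulr0.
Qed.

(** The moment commutes with all invariant kernels, so the projection fixes it. Its trace against
    [t] is the expectation of a quantity that does not depend on [U]. *)
Lemma haar_moment (i j : index) :
  moment i j = \sum_s \sum_t Wg R[i] N (s^-1 * t)%g * Trperm t (fun r => (lam r)%:C) *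
      (recolor i s == j)%:R.
Proof.
have HA := kcomm_invariant (kcomm_unitary moment_kcomm).
rewrite (Wg_commutant HA); apply: eq_bigr => s _; apply: eq_bigr => t _.
congr (_ * _ * _); rewrite -(cexpect_cst P (Trperm t (fun r => (lam r)%:C))).
transitivity (cexpect P (fun w => \sum_(k : index) 1 *
    tensorpow (conj_diag (U w)) k (recolor k t))).
  rewrite (cexpect_sum hU _ (fun k => regular_conj_diag k (recolor k t))).
  by apply: eq_bigr => k _; rewrite mul1r.
congr (cexpect P _); apply/funext => w; case: hU => Uu _ _.
under eq_bigr do rewrite mul1r.
exact: trace_conj_diag.
Qed.

End HaarMoments.

(** * Partial traces *)

Lemma prod_natb (R : comPzRingType) (I : finType) (b : pred I) :
  \prod_x (b x)%:R = [forall x, b x]%:R :> R.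
Proof.
case: forallP => [H|/forallP/forallPn [x bx]]; first by rewrite big1// => x _; rewrite H.
by rewrite (bigD1 x)//= (negPf bx) mul0r.
Qed.

Lemma prod_sum_fprod (R : comPzRingType) (I : finType) (T_ : I -> finType)
    (F : forall x, T_ x -> R) :
  \prod_x \sum_(y : T_ x) F x y = \sum_(t : fprod T_) \prod_x F x (t x).
Proof.
have e x : \sum_(y : T_ x) F x y =
    \sum_(y in tagged_with T_ x) untag 0 (finfun (F x)) y.
  rewrite -(big_tag (fun x (y : T_ x) => finfun (F x) y)).
  by apply: eq_bigr => y _; rewrite ffunE.
under eq_bigr do rewrite e.
rewrite bigA_distr_big_dep -big_fprod; apply: eq_bigr => t _.
by apply: eq_bigr => x _; rewrite ffunE.
Qed.

(** * Multi-indices and their digits *)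

Section Digits.
Variables (k : nat) (n : 'I_k -> nat).
Hypothesis n0 : forall j, (0 < n j)%N.

Lemma digit_ltn j r : (digit n j r < n j)%N.
Proof. by rewrite ltn_pmod. Qed.

Definition dig j r : 'I_(n j) := Ordinal (digit_ltn j r).

Lemma modn_mul_digit a b r : (0 < b)%N -> (r %% (a * b) = (r %/ b) %% a * b + r %% b)%N.
Proof.
move=> b0; rewrite {1}(divn_eq r b) {1}(divn_eq (r %/ b) a) mulnDl -mulnA -addnA modnMDl.
case: (posnP a) => [->|a0]; first by rewrite mul0n !modn0.
rewrite modn_small//; apply: (@leq_trans (((r %/ b) %% a).+1 * b)).
  by rewrite mulSn addnC ltn_add2r ltn_pmod.
by rewrite leq_mul2r ltn_pmod ?orbT.
Qed.

(** The digits of index at least [m] determine the residue modulo [W m], the product of the [n j]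
    with [m <= j]. The induction starts from the least significant digit and ends at [W 0], which
    exceeds both numbers. *)
Lemma digit_inj r r' : (r < Ntot n)%N -> (r' < Ntot n)%N ->
  (forall j, digit n j r = digit n j r') -> r = r'.
Proof.
move=> rN r'N e; pose W m := (\prod_(j < k | (m <= j)%N) n j)%N.
have W0 : W 0 = Ntot n by [].
have Wpos m : (0 < W m)%N by rewrite prodn_cond_gt0.
suff H m : (m <= k)%N -> (r %% W (k - m) = r' %% W (k - m))%N.
  by have := H k (leqnn k); rewrite subnn W0 !modn_small.
elim: m => [|m IH] mk.
  rewrite subn0 (_ : W k = 1%N) ?modn1// /W big_pred0// => j.
  by rewrite leqNgt ltn_ord.
have km : (k - m.+1 < k)%N by lia.
pose j := Ordinal km.
have WS : W (k - m.+1)%N = (n j * W (k - m))%N.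
  rewrite /W (bigD1 j)//=; congr (_ * _)%N; apply: eq_bigl => j'.
  by rewrite -(inj_eq val_inj) /=; lia.
rewrite WS !modn_mul_digit// IH; last by lia.
have := e j; rewrite /digit (_ : (\prod_(j' < k | (j < j')%N) n j')%N = W (k - m)%N); last first.
  by apply: eq_bigl => j' /=; rewrite subnSK.
by move=> ->.
Qed.

Variable d : nat.
Local Notation index := {ffun 'I_d -> 'I_(Ntot n)}.

Definition digits (i : index) : fprod (fun l => {ffun 'I_d -> 'I_(n l)}) :=
  fprod_of_fun (fun l => [ffun x => dig l (i x)]).

Lemma digitsE i l x : digits i l x = dig l (i x).
Proof. by rewrite fprodE ffunE. Qed.

Lemma digits_bij : bijective digits.
Proof.
apply: inj_card_bij.
  move=> i j e; apply/ffunP => x; apply/val_inj/digit_inj; try exact: ltn_ord.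
  move=> l; have := congr1 (fun t : fprod (fun l => {ffun 'I_d -> 'I_(n l)}) => t l x) e.
  by rewrite !digitsE => /(congr1 val).
rewrite card_fprod card_ffun !card_ord /Ntot.
rewrite (big_morph (fun m => m ^ d)%N (fun a b => expnMn a b d) (exp1n d)) leq_prod// => l _.
by rewrite card_ffun !card_ord.
Qed.

End Digits.

(** * First returns of a cycle to a block *)

Section FirstReturn.
Variables (k : nat) (p : 'I_k -> nat) (l : 'I_k).
Local Notation d := (\sum_(j < k) p j)%N.
Variable s : 'S_d.

Definition letter (a : 'I_(p l)) : 'I_d := tagnat.Rank l a.

Lemma letterE a : letter a = (off p l + a)%N :> nat.
Proof. exact: tagnat.RankEsum. Qed.

Lemma letter_inj : injective letter.
Proof.
by move=> a b e; apply/val_inj/eqP; rewrite -(eqn_add2l (off p l)) -!letterE e.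
Qed.

Lemma inblockP (x : 'I_d) : reflect (exists a, x = letter a) (inblock p l x).
Proof.
apply: (iffP idP) => [/andP[xl xu]|[a ->]]; last first.
  by rewrite /inblock letterE leq_addr ltn_add2l ltn_ord.
have xa : (x - off p l < p l)%N by rewrite ltn_subLR.
by exists (Ordinal xa); apply/val_inj; rewrite [RHS]letterE /= subnKC.
Qed.

Lemma inblock_letter a : inblock p l (letter a).
Proof. by apply/inblockP; exists a. Qed.

Lemma iter_permn m (x : 'I_d) : iter m (permn s) x = (s ^+ m)%g x.
Proof.
elim: m => [|m IH]; first by rewrite expg0 perm1.
by rewrite iterS IH /permn valK expgSr permM.
Qed.

(* [a] is the first letter of the block met when following the cycle of [x],
   starting with [x] itself. *)
Definition leads (x : 'I_d) (a : 'I_(p l)) : Prop :=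
  exists2 m, (s ^+ m)%g x = letter a &
    forall m', (m' < m)%N -> ~~ inblock p l ((s ^+ m')%g x).

Lemma leads_inj x a b : leads x a -> leads x b -> a = b.
Proof.
move=> [m ma mlt] [m' mb m'lt]; apply: letter_inj; rewrite -ma -mb.
case: (ltngtP m m') => [mm|mm|->//].
  by have := m'lt _ mm; rewrite ma inblock_letter.
by have := mlt _ mm; rewrite mb inblock_letter.
Qed.

Lemma leads_letter a : leads (letter a) a.
Proof. by exists 0%N => //; rewrite expg0 perm1. Qed.

Lemma leads_step (x : 'I_d) a : ~~ inblock p l x -> leads (s x) a <-> leads x a.
Proof.
move=> xB; split=> [[m e H]|[m]].
  exists m.+1; first by rewrite expgS permM.
  by case=> [_|m' mm]; [rewrite expg0 perm1|rewrite expgS permM H].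
case: m => [e|m e H]; first by move: xB; rewrite expg0 perm1 in e; rewrite e inblock_letter.
exists m; first by rewrite -permM -expgS.
by move=> m' mm; rewrite -permM -expgS H.
Qed.

Lemma leads_pr a : leads (s (letter a)) (pr s a).
Proof.
(* The iterate [m.+1] from the letter [a] is the iterate [m] from its image, where [leads]
   starts. *)
set x := letter a; pose Q m := inblock p l (iter m.+1 (permn s) (off p l + a)%N).
have QE m : Q m = inblock p l ((s ^+ m)%g (s x)).
  by rewrite /Q -letterE iter_permn expgS permM.
pose m := find Q (iota 0 d).
(* The cycle returns to [x] after at most [d] steps, so the search in [pr] succeeds. *)
have hasQ : has Q (iota 0 d).
  have c0 : (0 < #|porbit s x|)%N by apply/card_gt0P; exists x; exact: porbit_id.
  have cd : (#|porbit s x| <= d)%N.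
    by apply: leq_trans (max_card _) _; rewrite card_ord.
  apply/hasP; exists #|porbit s x|.-1; first by rewrite mem_iota leq0n add0n (prednK c0).
  by rewrite QE -permM -expgS (prednK c0) permX iter_porbit inblock_letter.
have md : (m < d)%N by rewrite -[X in (_ < X)%N](size_iota 0) -has_find.
have Qm : Q m by have := nth_find 0%N hasQ; rewrite nth_iota.
exists m; last first.
  move=> m' mm; have := before_find 0%N mm.
  by rewrite nth_iota ?add0n ?(ltn_trans mm)// QE => ->.
move: (Qm); rewrite QE => /inblockP [b eb]; rewrite eb; congr letter.
apply/val_inj; rewrite /pr -/m -letterE iter_permn expgS permM eb letterE.
by rewrite addKn insubdK // -topredE /= ltn_ord.
Qed.

Lemma leads_exists (x y : 'I_d) : y \in porbit s x -> inblock p l y -> exists a, leads x a.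
Proof.
move=> /porbitP [m ->] ym.
have exm : exists m, inblock p l ((s ^+ m)%g x) by exists m.
case: (ex_minnP exm) => m' /inblockP [a ea] Hm; exists a, m' => // j jm.
by apply: contraL jm => /Hm; rewrite -leqNgt.
Qed.

Lemma leads_porbit (x : 'I_d) a : leads x a -> letter a \in porbit s x.
Proof. by move=> [m <- _]; exact: mem_porbit. Qed.

End FirstReturn.

(** * Counting the digits compatible with prescribed entries *)

Section CountColourings.
Variables (k : nat) (p : 'I_k -> nat) (l : 'I_k).
Local Notation d := (\sum_(j < k) p j)%N.
Variables (s : 'S_d) (q : nat) (ii jj : 'I_(p l) -> 'I_q).
Hypothesis q0 : (0 < q)%N.

(** The constraints on the digits of index [l] when the column multi-index is the row multi-index
    recoloured by [s]: letters of the block carry the prescribed row and column, all others have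
    equal digits because this factor is traced out. *)
Definition compatible (u : {ffun 'I_d -> 'I_q}) : bool :=
  [forall a, (u (letter a) == ii a) && (u (s (letter a)) == jj a)] &&
  [forall x : 'I_d, ~~ inblock p l x ==> (u (s x) == u x)].

Lemma compatible_leads u x a : compatible u -> leads s x a -> u x = ii a.
Proof.
move=> /andP[/forallP H1 /forallP H2] [m]; elim: m x => [|m IH] x.
  by rewrite expg0 perm1 => -> _; case/andP: (H1 a) => /eqP.
rewrite expgS permM => e H.
have := implyP (H2 x); rewrite -[x]perm1 -(expg0 s) => /(_ (H 0%N isT)).
rewrite expg0 perm1 => /eqP <-; apply: IH => // m' mm.
by rewrite -permM -expgS H.
Qed.

Let free := {c | c \in [set c in porbits s | [forall x in c, ~~ inblock p l x]]}.

Let first (x : 'I_d) : option 'I_(p l) := [pick a | `[< leads s x a >]].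

Lemma firstP x a : leads s x a -> first x = Some a.
Proof.
move=> xa; rewrite /first; case: pickP => [b /asboolP xb|/(_ a)/asboolP//].
by rewrite (leads_inj xa xb).
Qed.

(** On a cycle meeting the block, the next block letter forces the value; a free cycle takes its
    colour from [h]. A letter without [first] lies on a free cycle, so the default [Ordinal q0] is
    never reached. *)
Let fill (h : {ffun free -> 'I_q}) : {ffun 'I_d -> 'I_q} :=
  [ffun x => if first x is Some a then ii a else
     if insub (porbit s x) is Some c then h c else Ordinal q0].

Lemma porbit_perm x : porbit s (s x) = porbit s x.
Proof.
apply/eqP; rewrite eq_porbit_mem.
by have := mem_porbit s 1 x; rewrite expg1.
Qed.

Lemma fill_compatible h : (forall a, ii (pr s a) = jj a) -> compatible (fill h).
Proof.
move=> iijj; apply/andP; split; apply/forallP; last first.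
  move=> x; apply/implyP => xB; rewrite !ffunE porbit_perm.
  rewrite (_ : first (s x) = first x)//; apply: eq_pick => a /=.
  by apply: asbool_equiv_eq; exact: leads_step.
move=> a; rewrite !ffunE (firstP (leads_letter s a)) (firstP (leads_pr s a)) iijj.
by rewrite !eqxx.
Qed.

Lemma free_rep (c : free) : exists x, val c == porbit s x.
Proof.
have := valP c; rewrite inE => /andP[/imsetP [x _ e] _].
by exists x; apply/eqP.
Qed.

Let rep (c : free) := xchoose (free_rep c).

Lemma first_free c x : x \in val (c : free) -> first x = None.
Proof.
move=> xc; rewrite /first; case: pickP => // a /asboolP /leads_porbit ax.
have := valP c; rewrite inE => /andP[/imsetP [y _ e]] /forallP/(_ (letter a)).
rewrite inblock_letter implybF => /negP; case.
rewrite e in xc *; rewrite -eq_porbit_mem in xc.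
by rewrite -(eqP xc).
Qed.

Lemma repP c : porbit s (rep c) = val c.
Proof. by rewrite -(eqP (xchooseP (free_rep c))). Qed.

Lemma fill_rep h c : fill h (rep c) = h c.
Proof.
have rc : rep c \in val c by rewrite -repP porbit_id.
rewrite ffunE (first_free rc) repP (_ : insub _ = Some c)//.
by rewrite valK.
Qed.

Lemma compatible_free u c x : compatible u -> x \in val (c : free) -> u x = u (rep c).
Proof.
move=> /andP[_ /forallP H] xc; have := valP c; rewrite inE => /andP[_ /forallP fc].
rewrite -repP in xc; case/porbitP: xc => m ->; elim: m => [|m IH].
  by rewrite expg0 perm1.
rewrite expgSr permM; have := implyP (H ((s ^+ m) (rep c))%g).
have := implyP (fc ((s ^+ m) (rep c))%g); rewrite -repP mem_porbit => /(_ isT) nB.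
by move=> /(_ nB) /eqP ->.
Qed.

Lemma fill_surj u : compatible u -> fill [ffun c => u (rep c)] = u.
Proof.
move=> uc; apply/ffunP => x; rewrite ffunE /first; case: pickP => [a /asboolP xa|nox].
  by rewrite (compatible_leads uc xa).
have xfree : porbit s x \in [set c in porbits s | [forall x in c, ~~ inblock p l x]].
  rewrite inE imset_f //=; apply/forallP => y; apply/implyP => yx; apply/negP => yB.
  by have [a /asboolP xa] := leads_exists yx yB; have := nox a; rewrite xa.
rewrite insubT ffunE; apply/esym/compatible_free => //.
by rewrite SubK porbit_id.
Qed.

(** Values are forced backwards from the block letters, consistently exactly when
    [ii (pr s a) = jj a] for all [a], while each cycle avoiding the block is coloured freely. *)
Lemma card_compatible :
  #|[set u | compatible u]| = ([forall a, ii (pr s a) == jj a] * q ^ kappa l s)%N.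
Proof.
case: forallP => [H|H].
  have Hij a : ii (pr s a) = jj a by apply/eqP.
  have finj : injective fill.
    by move=> g h /ffunP e; apply/ffunP => c; rewrite -!fill_rep e.
  rewrite mul1n (_ : [set u | _] = fill @: finset.setT).
    rewrite card_imset// cardsT card_ffun card_ord; congr (_ ^ _)%N.
    by rewrite /kappa card_sig.
  apply/setP => u; rewrite inE; apply/idP/imsetP => [uc|[h _ ->]].
    by exists [ffun c => u (rep c)]; rewrite ?finset.in_setT// fill_surj.
  exact: fill_compatible.
rewrite mul0n; apply: eq_card0 => u; rewrite inE; apply/negP => uc; apply: H => a.
have /andP[/forallP/(_ a)/andP[_ /eqP <-] _] := uc.
by rewrite (compatible_leads uc (leads_pr s a)).
Qed.

End CountColourings.

(** * Products of entries of partial traces *)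

Section PartialTraces.
Variables (k : nat) (n : 'I_k -> nat).
Hypothesis n0 : forall j, (0 < n j)%N.
Variables (p : 'I_k -> nat) (ii jj : forall l : 'I_k, 'I_(p l) -> 'I_(n l)).
Local Notation d := (\sum_(l < k) p l)%N.
Local Notation index := {ffun 'I_d -> 'I_(Ntot n)}.

(** The condition for the entry [(r, s)] of the matrix to occur in the partial trace attached to the
    letter [x]. *)
Definition glued (x : 'I_d) (r s : nat) : bool :=
  let l := tagnat.sig1 x in let a := tagnat.sig2 x in
  [&& digit n l r == ii a, digit n l s == jj a &
      [forall j : 'I_k, (j != l) ==> (digit n j r == digit n j s)]].

Lemma glued_letter l (a : 'I_(p l)) r s :
  glued (letter a) r s =
  [&& digit n l r == ii a, digit n l s == jj a &
      [forall j : 'I_k, (j != l) ==> (digit n j r == digit n j s)]].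
Proof. by rewrite /glued /letter /tagnat.sig1 /tagnat.sig2 /tagnat.Rank tagnat.rankK. Qed.

Lemma letter_sig (x : 'I_d) : letter (tagnat.sig2 x) = x.
Proof. exact: tagnat.sig2K. Qed.

(** Blocks are flattened into letters and the product is distributed: one entry chosen for each
    letter amounts to a pair of multi-indices. *)
Lemma prod_ptrace (C : comNzRingType) (M : 'M[C]_(Ntot n)) :
  \prod_(l < k) \prod_(a < p l) ptrace l M (ii a) (jj a) =
  \sum_(u : index * index) (\prod_x (glued x (u.1 x) (u.2 x))%:R) *
     \prod_x M (u.1 x) (u.2 x).
Proof.
pose G (x : 'I_d) (rs : 'I_(Ntot n) * 'I_(Ntot n)) : C :=
  (glued x rs.1 rs.2)%:R * M rs.1 rs.2.
transitivity (\prod_x \sum_rs G x rs).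
  rewrite (sig_big_dep predT (fun=> predT)
    (fun l (a : 'I_(p l)) => ptrace l M (ii a) (jj a))) /=.
  rewrite (reindex (@tagnat.sig k p)); last exact: onW_bij (@tagnat.sig_bij k p).
  apply: eq_bigr => x _; rewrite mxE pair_bigA /=; apply: eq_bigr => rs _.
  by rewrite /G /glued; case: ifP => _; rewrite ?mul1r ?mul0r.
rewrite bigA_distr_bigA /= (reindex (fun u : index * index => [ffun x => (u.1 x, u.2 x)])) /=.
  apply: eq_bigr => u _; rewrite -big_split; apply: eq_bigr => x _.
  by rewrite ffunE.
exists (fun f : {ffun 'I_d -> 'I_(Ntot n) * 'I_(Ntot n)} =>
    ([ffun x => (f x).1], [ffun x => (f x).2])) => [[u v] _|f _].
  by congr pair; apply/ffunP => x; rewrite !ffunE.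
by apply/ffunP => x; rewrite !ffunE -surjective_pairing.
Qed.

(** Once the column multi-index is eliminated, the constraints on digits of distinct indices [l] are
    independent, so the sum is a product of the counts of [card_compatible]. *)
Lemma sum_glued (C : comNzRingType) (s : 'S_d) :
  \sum_(u : index * index) (\prod_x (glued x (u.1 x) (u.2 x))%:R) *
     (recolor u.1 s == u.2)%:R =
  \prod_(l < k) (deltap C (pr s) (@ii l) (@jj l) * (n l)%:R ^+ kappa l s).
Proof.
transitivity (\sum_(i : index) \prod_x (glued x (i x) (i (s x)))%:R : C).
  rewrite -(pair_bigA _ (fun i j : index => (\prod_x (glued x (i x) (j x))%:R) *
     (recolor i s == j)%:R)) /=.
  apply: eq_bigr => i _; rewrite (bigD1 (recolor i s))//= eqxx mulr1.
  rewrite [X in _ + X]big1 ?addr0 => [|j /negPf ji]; last by rewrite eq_sym ji mulr0.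
  by apply: eq_bigr => x _; rewrite ffunE.
(* A multi-index is replaced by its family of digit colourings, one for each tensor factor. *)
transitivity (\sum_(t : fprod (fun l => {ffun 'I_d -> 'I_(n l)}))
    \prod_(l < k) (compatible s (@ii l) (@jj l) (t l))%:R : C).
  rewrite [RHS](reindex (@digits _ _ n0 d)); last exact: onW_bij (digits_bij n0 d).
  apply: eq_bigr => i _; rewrite !prod_natb; congr (nat_of_bool _)%:R.
  apply/forallP/forallP => [H l|H x].
    apply/andP; split; apply/forallP.
      move=> a; rewrite !digitsE -!val_eqE /=.
      by have := H (letter a); rewrite glued_letter => /and3P [-> ->].
    move=> x; apply/implyP => xl; rewrite !digitsE -val_eqE /= eq_sym.
    have := H x; rewrite -{1}(letter_sig x) glued_letter => /and3P [_ _ /forallP/(_ l)].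
    move=> /implyP; apply; apply: contra xl => /eqP e.
    by rewrite -(letter_sig x) e inblock_letter.
  rewrite -{1}(letter_sig x) glued_letter; apply/and3P; split.
  - have /andP [/forallP/(_ (tagnat.sig2 x))/andP [+ _] _] := H (tagnat.sig1 x).
    by rewrite letter_sig digitsE -val_eqE.
  - have /andP [/forallP/(_ (tagnat.sig2 x))/andP [_ +] _] := H (tagnat.sig1 x).
    by rewrite letter_sig digitsE -val_eqE.
  - apply/forallP => l; apply/implyP => lx.
    have /andP [_ /forallP/(_ x)] := H l; rewrite !digitsE -val_eqE /= eq_sym.
    move=> /implyP; apply; apply: contra lx => /inblockP [a ->].
    by rewrite /letter tagnat.Rank1K.
rewrite -(prod_sum_fprod (fun l (u : {ffun 'I_d -> 'I_(n l)}) =>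
  (compatible s (@ii l) (@jj l) u)%:R)).
apply: eq_bigr => l _.
transitivity (#|[set u | compatible s (@ii l) (@jj l) u]|%:R : C).
  by rewrite -sum1dep_card natr_sum [RHS]big_mkcond; apply: eq_bigr => u _; case: ifP.
rewrite card_compatible ?n0// natrM natrX; congr (_ * _).
by rewrite /deltap prod_natb.
Qed.

End PartialTraces.

Unset Implicit Arguments.
Set Strict Implicit.

Theorem theorem2p5
  (R : realType) (k : nat) (n : 'I_k -> nat)
  (hk : (2 <= k)%N) (hn : forall j, (2 <= n j)%N)
  (lam : 'I_(Ntot n) -> R)
  (d : measure_display) (Omega : measurableType d) (P : probability Omega R)
  (U : Omega -> 'M[R[i]]_(Ntot n))
  (hU : haar_distributed P U)
  (p : 'I_k -> nat)
  (ii jj : forall l : 'I_k, 'I_(p l) -> 'I_(n l)) :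
  let H := fun w => U w *m diag_mx (\row_r (lam r)%:C) *m adj (U w) in
  cexpect P (fun w =>
    \prod_(l < k) \prod_(a < p l) ptrace l (H w) (ii l a) (jj l a))
  = \sum_(s : 'S_(\sum_(l < k) p l)) \sum_(t : 'S_(\sum_(l < k) p l))
      Wg R[i] (Ntot n) (s^-1 * t)%g * Trperm t (fun r => (lam r)%:C)
      * \prod_(l < k) (deltap _ (@pr _ p l s) (ii l) (jj l)
                        * (n l)%:R ^+ @kappa _ p l s).
Proof.
move=> H; have n0 j : (0 < n j)%N by apply: leq_trans (hn j).
pose D := (\sum_(l < k) p l)%N.
pose T (s t : 'S_D) : R[i] := Wg R[i] (Ntot n) (s^-1 * t)%g * Trperm t (fun r => (lam r)%:C).
(* The coefficients, independent of [U], of the entries of the tensor power of [H] in the product of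
   partial traces. *)
pose c (u : {ffun 'I_D -> 'I_(Ntot n)} * {ffun 'I_D -> 'I_(Ntot n)}) : R[i] :=
  \prod_x (glued ii jj x (u.1 x) (u.2 x))%:R.
transitivity (cexpect P (fun w => \sum_u c u * tensorpow (conj_diag lam (U w)) u.1 u.2)).
  by congr (cexpect P _); apply/funext => w; rewrite prod_ptrace.
rewrite (cexpect_sum hU _ (fun u => regular_conj_diag lam u.1 u.2)).
transitivity (\sum_u c u * \sum_s \sum_t T s t * (recolor u.1 s == u.2)%:R).
  by apply: eq_bigr => u _; rewrite -(haar_moment hU lam).
under eq_bigr do rewrite big_distrr/=.
rewrite exchange_big/=; apply: eq_bigr => s _.
under eq_bigr do rewrite big_distrr/=.
rewrite exchange_big/=; apply: eq_bigr => t _.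
rewrite -(sum_glued n0) big_distrr/=; apply: eq_bigr => u _.
by rewrite mulrCA.
Qed.
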